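(* Let $\Gamma$ be a finitely presented group with a finite generating set $S$ and let $\pi$ be a representation of $\Gamma$ on a Banach space $E$. Assume that $H^2(\Gamma,\pi)$ is reduced and that every affine action of $\Gamma$ on $E$ with linear part $\pi$ has a fixed point. Then there exists $\varepsilon=\varepsilon(\Gamma,S,\pi)>0$ such that if a representation $\rho$ of $\Gamma$ on $E$ is an $\varepsilon$-deformation of $\pi$, then every affine action of $\Gamma$ on $E$ with linear part $\rho$ has a fixed point.
   Context: A representation of $\Gamma$ on a Banach space $E$ is a homomorphism $\gamma\mapsto\pi_\gamma$ from $\Gamma$ to the group of bounded invertible linear operators on $E$ (no uniform boundedness is assumed). A representation $\rho$ on the same $E$ is an $\varepsilon$-deformation of $\pi$ if $\sup_{s\in S}\|\pi_s-\rho_s\|_{B(E)}\le\varepsilon$. An affine action with linear part $\pi$ is an action of the form $\gamma\cdot v=\pi_\gamma v+b_\gamma$ with $b_\gamma\in E$. Since $\Gamma$ is finitely presented it has an Eilenberg-MacLane simplicial complex with finite $2$-skeleton; let $X$ be its universal cover. Let $C^k(X,\pi)$ be the space of alternating functions $f$ from ordered $k$-simplices of $X$ to $E$ with $f(\gamma\sigma)=\pi_\gamma f(\sigma)$, and $d^k f(\sigma)=\sum_{i=0}^{k+1}(-1)^i f(\sigma_i)$, where $\sigma_i$ omits the $i$-th vertex. $H^k(\Gamma,\pi)=\ker d^k/\operatorname{im}d^{k-1}$. For $k\le 2$, $C^k(X,\pi)$ is identified, by evaluation on finitely many orbit representatives, with a finite direct sum of copies of $E$ and so is a Banach space. $H^2(\Gamma,\pi)$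 is reduced if $\operatorname{im}d^1$ is closed in $C^2(X,\pi)$. *)

(* Defs.v *)
From HB Require Import structures.
From mathcomp Require Import all_boot all_order all_algebra all_fingroup.
From mathcomp Require Import finmap.
From mathcomp Require Import all_classical all_reals all_analysis.

Set Implicit Arguments.
Unset Strict Implicit.
Unset Printing Implicit Defensive.

Import Order.TTheory GRing.Theory Num.Theory.
Import numFieldNormedType.Exports.

Local Open Scope classical_set_scope.
Local Open Scope ring_scope.

Section Groups.
Variable G : groupType.

Definition generates (S : {fset G}) : Prop :=
  forall H : {pred G}, group_closed H -> {subset S <= H} -> forall g, g \in H.

(* Words in the letters x_i (i, true) and x_i^-1 (i, false). *)
Definition word (n : nat) := seq ('I_n * bool).

Definition eval_word (n : nat) (a : 'I_n -> G) (w : word n) : G :=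
  (\prod_(l <- w) (if l.2 then a l.1 else (a l.1)^-1))%g.

(* Equality in the group < x_i | r, r \in rels >. *)
Inductive pres_eq (n : nat) (rels : seq (word n)) : word n -> word n -> Prop :=
| pres_refl w : pres_eq rels w w
| pres_sym w w' : pres_eq rels w w' -> pres_eq rels w' w
| pres_trans w w' w'' :
    pres_eq rels w w' -> pres_eq rels w' w'' -> pres_eq rels w w''
| pres_cancel u v i b :
    pres_eq rels (u ++ [:: (i, b); (i, ~~ b)] ++ v) (u ++ v)
| pres_rel u v r : r \in rels -> pres_eq rels (u ++ r ++ v) (u ++ v).

Definition finitely_presented : Prop :=
  exists (n : nat) (a : 'I_n -> G) (rels : seq (word n)),
    (forall g, exists w, eval_word a w = g) /\
    (forall w w', eval_word a w = eval_word a w' <-> pres_eq rels w w').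

End Groups.

(* The scalars are real.  Complex Banach spaces are covered by restriction of
   scalars: norms, operator norms, closed sets and affine actions with a given
   linear part do not depend on the scalar field. *)
Section Representations.
Variables (R : realType) (G : groupType) (E : completeNormedModType R).

(* Invertibility in B(E) is automatic: rep_op g^-1 is a continuous inverse of
   rep_op g. *)
Record representation := Representation {
  rep_op :> G -> {linear E -> E};
  rep_continuous : forall g, continuous (rep_op g);
  rep1 : forall v, rep_op 1%g v = v;
  repM : forall g h v, rep_op (g * h)%g v = rep_op g (rep_op h v) }.

(* Only meaningful for bounded T: [sup] of an unbounded set is 0. *)
Definition opnorm (T : E -> E) : R :=
  sup [set `|T v| | v in [set v : E | `|v| <= 1]].

Definition eps_deformation (S : {fset G}) (eps : R) (pi rho : representation) :
    Prop :=
  forall s, s \in S -> opnorm (fun v => pi s v - rho s v) <= eps.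

Definition affine_action (pi : representation) (a : G -> E -> E) : Prop :=
  [/\ forall v, a 1%g v = v,
      forall g h v, a (g * h)%g v = a g (a h v)
    & exists b : G -> E, forall g v, a g v = pi g v + b g].

Definition affine_fixed_point_property (pi : representation) : Prop :=
  forall a, affine_action pi a -> exists v, forall g, a g v = v.

End Representations.

Record simplicial_complex (V : choiceType) := SimplicialComplex {
  simplex :> {fset V} -> Prop;
  simplex_neq0 : forall s, simplex s -> s != fset0;
  simplex1 : forall v, simplex [fset v]%fset;
  simplexS : forall s t, simplex s -> (t `<=` s)%fset -> t != fset0 ->
    simplex t }.

Section Realization.
Variables (R : realType) (V : choiceType) (X : simplicial_complex V).

(* Barycentric coordinates of the points of the closed simplex spanned by s. *)
Definition closed_simplex (s : {fset V}) : set (V -> R) :=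
  [set t | [/\ forall v, 0 <= t v, forall v, v \notin s -> t v = 0
             & \sum_(v <- s) t v = 1]].

Record realization := Realization {
  bary :> V -> R;
  baryP : exists2 s, X s & closed_simplex s bary }.

HB.instance Definition _ := gen_eqMixin realization.
HB.instance Definition _ := gen_choiceMixin realization.

(* The coherent (weak) topology: U is open iff its trace on each closed simplex
   is open for the Euclidean topology, which on a closed simplex is the
   topology of pointwise convergence of barycentric coordinates. *)
Definition realization_open (U : set realization) : Prop :=
  forall s, X s -> exists2 Q : set {ptws V -> R}, open Q &
    forall x : realization, closed_simplex s x -> (U x <-> Q (x : V -> R)).

Let ropenT : realization_open setT.
Proof. by move=> s _; exists setT => //; exact: openT. Qed.

Let ropenI A B : realization_open A -> realization_open B ->
  realization_open (A `&` B).
Proof.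
move=> oA oB s Xs; have [Q oQ AQ] := oA s Xs; have [P oP BP] := oB s Xs.
exists (Q `&` P); first exact: openI.
by move=> x sx; split=> -[] /(AQ x sx) ? /(BP x sx).
Qed.

Let ropen_bigU (I : Type) (f : I -> set realization) :
  (forall i, realization_open (f i)) -> realization_open (\bigcup_i f i).
Proof.
move=> of_ s Xs.
have /choice[Q QP] : forall i, exists Q : set {ptws V -> R}, open Q /\
    forall x : realization, closed_simplex s x -> (f i x <-> Q (x : V -> R)).
  by move=> i; have [Q ? ?] := of_ i s Xs; exists Q.
exists (\bigcup_i Q i); first by apply: bigcup_open => i _; have [] := QP i.
move=> x sx; split=> -[i _ ?]; exists i => //; exact/(proj2 (QP i) x sx).
Qed.

HB.instance Definition _ :=
  isOpenTopological.Build realization ropenT ropenI ropen_bigU.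

End Realization.

Definition contractible (R : realType) (T : topologicalType) : Prop :=
  exists (x0 : T) (H : T * R -> T),
    [/\ {within setT `*` `[0, 1]%classic, continuous H},
        forall x, H (x, 0) = x & forall x, H (x, 1) = x0].

Section UniversalCover.
Variables (G : groupType) (V W : choiceType).
Variables (X : simplicial_complex V) (K : simplicial_complex W).

(* p maps the star of each vertex x isomorphically onto the star of p x. *)
Definition simplicial_covering (p : V -> W) : Prop :=
  [/\ forall w, exists x, p x = w,
      forall s, X s -> K [fset p v | v in s]%fset /\ {in s &, injective p}
    & forall x t, K t -> p x \in t ->
        exists! s, [/\ X s, x \in s & [fset p v | v in s]%fset = t]].

Definition simplicial_action (act : G -> V -> V) : Prop :=
  [/\ forall x, act 1%g x = x,
      forall g h x, act (g * h)%g x = act g (act h x)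
    & forall g s, X s -> X [fset act g v | v in s]%fset].

(* K is an Eilenberg-MacLane complex K(G, 1) with finite 2-skeleton, and
   p : X -> K its universal cover, on which G = pi_1(K) acts as the group of
   deck transformations: X is contractible, and G acts simply transitively on
   the fibres of p. *)
Definition EilenbergMacLane_universal_cover (R : realType)
    (p : V -> W) (act : G -> V -> V) : Prop :=
  [/\ finite_set [set t | K t /\ (#|` t| <= 3)%N],
      contractible R (realization R X),
      simplicial_covering p,
      simplicial_action act
    & forall x y, p x = p y <-> exists! g, act g x = y].

End UniversalCover.

Section Cohomology.
Variables (R : realType) (G : groupType) (E : completeNormedModType R).
Variables (V : choiceType) (X : simplicial_complex V) (act : G -> V -> V).
Variable pi : representation G E.

Definition osimplex (k : nat) (s : {ffun 'I_k.+1 -> V}) : Prop :=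
  injective s /\ X [fset s i | i in 'I_k.+1]%fset.

Definition face (k : nat) (i : 'I_k.+2) (s : {ffun 'I_k.+2 -> V}) :
    {ffun 'I_k.+1 -> V} :=
  [ffun j => s (lift i j)].

Definition osimplex_act (k : nat) (g : G) (s : {ffun 'I_k.+1 -> V}) :
    {ffun 'I_k.+1 -> V} :=
  [ffun i => act g (s i)].

Definition osimplex_perm (k : nat) (t : 'S_k.+1) (s : {ffun 'I_k.+1 -> V}) :
    {ffun 'I_k.+1 -> V} :=
  [ffun i => s (t i)].

(* Functions on ordered simplices are extended by 0 to all vertex tuples. *)
Definition cochain (k : nat) : set ({ffun 'I_k.+1 -> V} -> E) :=
  [set f | [/\ forall s, ~ osimplex s -> f s = 0,
               forall (t : 'S_k.+1) s,
                 osimplex s -> f (osimplex_perm t s) = (-1) ^+ t *: f s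
             & forall g s, osimplex s -> f (osimplex_act g s) = pi g (f s)]].

Definition coboundary (k : nat) (f : {ffun 'I_k.+1 -> V} -> E) :
    {ffun 'I_k.+2 -> V} -> E :=
  fun s => if `[< osimplex s >] then \sum_(i < k.+2) (-1) ^+ i *: f (face i s)
           else 0.

(* One ordered k-simplex for each G-orbit of (unordered) k-simplices. *)
Definition orbit_representatives (k n : nat)
    (r : 'I_n -> {ffun 'I_k.+1 -> V}) : Prop :=
  (forall j, osimplex (r j)) /\
  (forall s, osimplex s ->
     exists! j, exists (g : G) (t : 'S_k.+1),
       s = osimplex_act g (osimplex_perm t (r j))).

(* Closedness in C^k, identified with the finite direct sum of copies of E by
   evaluation on orbit representatives; the product topology on 'I_n -> E is
   that of the Banach space E^n. *)
Definition closed_in_cochain (k : nat) (A : set ({ffun 'I_k.+1 -> V} -> E)) :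
    Prop :=
  exists (n : nat) (r : 'I_n -> {ffun 'I_k.+1 -> V}),
    orbit_representatives r /\
    closed [set ((fun j => f (r j)) : {ptws 'I_n -> E}) | f in A].

Definition H2_reduced : Prop :=
  closed_in_cochain [set coboundary f | f in @cochain 1%N].

End Cohomology.

(* Main.v *)
(* Let C^k(pi) be the simplicial cochains of X.  A contraction of |X| lifts to
   every principal bundle with discrete structure group, so that X is connected
   and every 1-cocycle of X is the coboundary of a function on the vertices; hence
   fixed points of all affine actions with linear part pi are equivalent to
   Z^1(pi) = d C^0(pi).  By the open mapping theorem, d : C^0(pi) -> Z^1(pi) and,
   since H^2 is reduced, d : C^1(pi) -> d C^1(pi) have bounded (non-linear) right
   inverses.  Let rho be close to pi and f in Z^1(rho).  The pi-equivariant cochain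
   f' that agrees with f on orbit representatives has a small coboundary, so that
   f' - h is in Z^1(pi) for some small h, and f' - h = d c.  The rho-equivariant
   cochain c' that agrees with c on representatives satisfies
   |f - d c'| <= |f| / 2, and iterating this gives f in d C^0(rho). *)
Require Import Defs.
From HB Require Import structures.
From mathcomp Require Import all_boot all_order all_algebra all_fingroup.
From mathcomp Require Import finmap.
From mathcomp Require Import all_classical all_reals all_analysis.
From mathcomp Require Import ring lra.
Import Order.TTheory GRing.Theory Num.Theory.
Import numFieldNormedType.Exports.
Local Open Scope ring_scope.

Local Open Scope classical_set_scope.

(** * Monodromy along a contraction *)

(** The obstacle is that closed images and bounded inverses are known for [pi] only, while [eps] has
    to be chosen before [rho]. All constants are therefore taken from [pi], and for [rho] only
    approximate primitives are constructed; the iteration from the proof of the open mapping theorem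
    turns these into exact ones. The equivariant cochains of [pi] and of [rho] form different
    spaces, and agreement on orbit representatives is the only link between them. It does not
    commute with [d]: a representative triangle has edges that are translates of representative
    edges, and each translation costs the distance between [pi] and [rho] at one group element.
    Finitely many representatives involve finitely many group elements, and closeness on [S]
    propagates to these. Norms are maxima over the representatives as well: seminorms on all
    functions, norms on equivariant ones. *)

(** Induction along the interval: the supremum of the [t] with [Q a t] is attained and cannot lie
    below [b]. It stands in for compactness; since the local hypothesis only concerns intervals
    around [t], no Lebesgue number is needed. *)
Lemma cousin (R : realType) (Q : R -> R -> Prop) (a b : R) :
  a <= b ->
  (forall x y z, a <= x -> x <= y -> y <= z -> z <= b ->
     Q x y -> Q y z -> Q x z) ->
  (forall t, a <= t <= b -> exists2 e, 0 < e & forall x y,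
     a <= x -> x <= t -> t <= y -> y <= b -> t - e < x -> y < t + e -> Q x y) ->
  Q a b.
Proof.
move=> ab Qtrans Qloc.
pose A := [set t | a <= t <= b /\ Q a t].
have Aa : A a.
  have aab : a <= a <= b by rewrite lexx.
  have [e e0 He] := Qloc a aab; split=> //.
  by apply: He; rewrite ?lexx //; lra.
have Aub : has_ubound A by exists b => t [/andP[]].
have Asup : has_sup A by split=> //; exists a.
pose m := sup A.
have am : a <= m by exact: ub_le_sup.
have mb : m <= b by apply: ge_sup; [exists a|move=> t [/andP[]]].
have amb : a <= m <= b by rewrite am.
have [e e0 He] := Qloc m amb.
have Qam : Q a m.
  have [t [/andP[at_ tb] Qat] mt] := sup_adherent e0 Asup.
  have tm : t <= m by apply: ub_le_sup => //; split=> //; rewrite at_.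
  apply: (Qtrans a t m) => //; apply: He => //; first lra.
have [bm|bm] := leP b (m + e / 2).
  apply: (Qtrans a m b) => //; apply: He => //; lra.
have : A (m + e / 2).
  split; first by apply/andP; split; lra.
  apply: (Qtrans a m) => //; first lra.
  + lra.
  + apply: He => //; lra.
move=> /(ub_le_sup Aub); rewrite -/m; lra.
Qed.

Lemma locally_constant_segment (R : realType) (A : Type) (k : R -> A) (a b : R) :
  a <= b ->
  (forall t, a <= t <= b -> exists2 e, 0 < e &
     forall t', a <= t' <= b -> `|t' - t| < e -> k t' = k t) ->
  k a = k b.
Proof.
move=> ab kloc; apply: (@cousin R (fun x y => k x = k y)) => //.
  by move=> x y z _ _ _ _ -> ->.
move=> t tab; have [e e0 He] := kloc t tab; exists e => // x y ax xt ty yb tx yt.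
rewrite (He x) ?(He y) //.
- by apply/andP; split; lra.
- by rewrite ltr_norml; apply/andP; split; lra.
- by apply/andP; split; lra.
- by rewrite ltr_norml; apply/andP; split; lra.
Qed.

Section Monodromy.
Variables (R : realType) (Y : topologicalType) (V : Type) (A : zmodType).
Variables (U : V -> set Y) (G : V -> Y -> A).
Hypothesis U_open : forall u, open (U u).
Hypothesis U_cover : forall y, exists u, U u y.
Hypothesis G_transition : forall u u', exists c, forall y,
  U u y -> U u' y -> G u' y - G u y = c.

Lemma transition_eq u u' y y' : U u y -> U u' y -> U u y' -> U u' y' ->
  G u' y - G u y = G u' y' - G u y'.
Proof. by move=> *; have [c Hc] := G_transition u u'; rewrite !Hc. Qed.

(* [q + G u] is the local coordinate over [U u] of a lift of the path [g] to the
   principal [A]-bundle with locally constant transition functions [G u' - G u]. *)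
Definition path_lift (g : R -> Y) (q : R -> A) (a b : R) : Prop :=
  forall t u, a <= t <= b -> U u (g t) -> exists2 e, 0 < e &
    forall t', a <= t' <= b -> `|t' - t| < e -> q t' + G u (g t') = q t + G u (g t).

(** Being a lift only constrains differences of [q], so the second lift may be translated by a
    constant to meet the first one at [b]. *)
Lemma path_lift_cat (g : R -> Y) (q q' : R -> A) (a b c : R) :
  a <= b -> b <= c -> path_lift g q a b -> path_lift g q' b c ->
  path_lift g (fun t => if t <= b then q t else q' t + (q b - q' b)) a c.
Proof.
move=> ab bc Hq Hq' t u /andP[at_ tc] Ut.
have Lq : t <= b -> exists2 e, 0 < e & forall t', a <= t' <= b ->
    `|t' - t| < e -> q t' + G u (g t') = q t + G u (g t).
  by move=> tb; apply: Hq => //; rewrite at_.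
have Lq' : b <= t -> exists2 e, 0 < e & forall t', b <= t' <= c ->
    `|t' - t| < e -> q' t' + G u (g t') = q' t + G u (g t).
  by move=> bt; apply: Hq' => //; rewrite bt.
have [tb|tb|tb] := ltgtP t b.
- have [e e0 He] := Lq (ltW tb).
  exists (Num.min e (b - t)); first by rewrite lt_min e0 subr_gt0.
  move=> t' /andP[at' tc']; rewrite lt_min ltr_norml => /andP[/andP[? ?]].
  rewrite ltr_norml => /andP[? ?].
  rewrite ifT; last lra.
  by apply: He; rewrite ?ltr_norml; apply/andP; split; lra.
- have [e e0 He] := Lq' (ltW tb).
  exists (Num.min e (t - b)); first by rewrite lt_min e0 subr_gt0.
  move=> t' /andP[at' tc']; rewrite lt_min !ltr_norml => /andP[/andP[? ?] /andP[? ?]].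
  rewrite ifF; last by apply/negbTE; rewrite -ltNge; lra.
  rewrite [LHS]addrAC He; last by rewrite ltr_norml; apply/andP; split; lra.
    by rewrite [RHS]addrAC.
  by apply/andP; split; lra.
- subst t; have [e e0 He] := Lq (lexx b); have [e' e0' He'] := Lq' (lexx b).
  exists (Num.min e e'); first by rewrite lt_min e0.
  move=> t' /andP[at' tc']; rewrite lt_min => /andP[te te'].
  have [tb'|tb'] := leP t' b; first by rewrite He // at'.
  rewrite [LHS]addrAC He'; last by [].
    by rewrite [LHS]addrC addrA subrK.
  by rewrite tc' ltW.
Qed.

Definition continuous_path (g : R -> Y) : Prop :=
  forall t O, 0 <= t <= 1 -> open O -> O (g t) -> exists2 e, 0 < e &
    forall t', 0 <= t' <= 1 -> `|t' - t| < e -> O (g t').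

Lemma path_lift_exists (g : R -> Y) : continuous_path g ->
  exists q, path_lift g q 0 1.
Proof.
move=> gc; apply: (@cousin R (fun a b => exists q, path_lift g q a b)) => //.
  move=> a b c _ ab bc _ [q Hq] [q' Hq'].
  by exists (fun t => if t <= b then q t else q' t + (q b - q' b)); exact: path_lift_cat.
move=> t t01; have [u0 U0] := U_cover (g t).
have [e e0 He] := gc t (U u0) t01 (U_open u0) U0.
(* This lift has coordinate 0 over [U u0] all along the short path. *)
exists e => // x y x0 xt ty y1 tx yt; exists (fun t => - G u0 (g t)).
move=> s u /andP[xs sy] Us.
have s01 : 0 <= s <= 1 by apply/andP; split; lra.
have [e' e0' He'] := gc s (U u) s01 (U_open u) Us.
exists e' => // s' /andP[xs' sy'] ss'.
rewrite addrC (addrC (- _)); apply: transition_eq => //.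
- apply: He; rewrite ?ltr_norml; apply/andP; split; lra.
- by apply: He' => //; apply/andP; split; lra.
- apply: He; rewrite ?ltr_norml; apply/andP; split; lra.
Qed.

Lemma path_lift_const (g : R -> Y) q u a b a' b' : path_lift g q a' b' ->
  a' <= a -> a <= b -> b <= b' -> (forall t, a <= t <= b -> U u (g t)) ->
  q a + G u (g a) = q b + G u (g b).
Proof.
move=> Hq aa' ab bb' Uab.
apply: (@locally_constant_segment R A (fun t => q t + G u (g t))) => // t tab.
have /andP[at_ tb] := tab.
have [||e e0 He] := Hq t u; [by apply/andP; split; lra|exact: Uab|].
exists e => // t' /andP[? ?] tt'; apply: He => //; apply/andP; split; lra.
Qed.

Variables (y0 : Y) (H : Y * R -> Y).
Hypothesis H_cont : forall y t O, 0 <= t <= 1 -> open O -> O (H (y, t)) ->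
  exists2 e, 0 < e & exists2 N, nbhs y N &
    forall y' t', N y' -> 0 <= t' <= 1 -> `|t' - t| < e -> O (H (y', t')).
Hypothesis H0 : forall y, H (y, 0) = y.
Hypothesis H1 : forall y, H (y, 1) = y0.

Lemma contraction_path y : continuous_path (fun t => H (y, t)).
Proof.
move=> t O t01 oO Ot; have [e e0 [N Ny He]] := H_cont y t O t01 oO Ot.
by exists e => // t' t01' tt'; apply: He => //; exact: nbhs_singleton.
Qed.

(* Monodromy: the change of a lift along the path [t |-> H (y, t)] depends on
   [y] in a locally constant way. *)
Lemma contraction_section : exists p : Y -> A, forall y u, U u y ->
  \forall y' \near y, p y' + G u y' = p y + G u y.
Proof.
have /choice[q Hq] : forall y, exists q, path_lift (fun t => H (y, t)) q 0 1.
  by move=> y; apply: path_lift_exists; exact: contraction_path.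
pose s y t u := q y t + G u (H (y, t)).
have sB y t u u' : s y t u' - s y t u = G u' (H (y, t)) - G u (H (y, t)).
  by rewrite /s opprD addrACA subrr add0r.
(* The lifts [q y] were chosen independently for each [y], so their values at nearby points are
   unrelated; only the increments from [a] to [b], read in fixed charts, can be compared. *)
pose Q y a b := forall u u', U u (H (y, a)) -> U u' (H (y, b)) ->
  \forall y' \near y, s y' b u' - s y' a u = s y b u' - s y a u.
have sloc y : Q y 0 1.
  apply: (@cousin R (Q y)) => //.
    move=> a b c a0 ab bc c1 Qab Qbc u u' Uu Uu'.
    have [v Uv] := U_cover (H (y, b)).
    have E y' : s y' c u' - s y' a u = (s y' c u' - s y' b v) + (s y' b v - s y' a u).
      by rewrite addrA subrK.
    rewrite E; near=> y'; rewrite E.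
    congr (_ + _); first by near: y'; exact: Qbc.
    by near: y'; exact: Qab.
  move=> t t01; have [v Uv] := U_cover (H (y, t)).
  have [e e0 [N Ny He]] := H_cont y t (U v) t01 (U_open v) Uv.
  exists e => // a b a0 at_ tb b1 ta bt u u' Uu Uu'.
  have ab : a <= b by lra.
  have a01 : 0 <= a <= 1 by apply/andP; split; lra.
  have b01 : 0 <= b <= 1 by apply/andP; split; lra.
  have HU y' c : N y' -> a <= c <= b -> U v (H (y', c)).
    move=> Ny' /andP[? ?]; apply: He => //; rewrite ?ltr_norml; apply/andP; split; lra.
  (* Between [a] and [b] the path of [y'] stays in [U v], where the coordinate of the lift is
     constant. What remains of the increment is one change of chart at each end, which is locally
     constant in [y']. *)
  have E y' : N y' -> s y' b u' - s y' a u =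
      (s y' b u' - s y' b v) + (s y' a v - s y' a u).
    move=> Ny'; have -> : s y' a v = s y' b v.
      apply: (path_lift_const (fun t => H (y', t)) (q y') v a b 0 1) => // c.
      exact: HU.
    by rewrite addrA subrK.
  have [ea ea0 [Na Nay Hea]] := H_cont y a (U u) a01 (U_open u) Uu.
  have [eb eb0 [Nb Nby Heb]] := H_cont y b (U u') b01 (U_open u') Uu'.
  rewrite E; last exact: nbhs_singleton.
  have aab : a <= a <= b by rewrite lexx.
  have bab : a <= b <= b by rewrite ab lexx.
  near=> y'.
  have Ny' : N y' by near: y'.
  have Nay' : Na y' by near: y'.
  have Nby' : Nb y' by near: y'.
  have Ny0 : N y by exact: nbhs_singleton.
  rewrite E // !sB; congr (_ + _); apply: transition_eq => //; try exact: HU.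
  - by apply: Heb => //; rewrite subrr normr0.
  - by apply: Hea => //; rewrite subrr normr0.
have [v Uv] := U_cover y0.
(* All paths end at [y0], so the lifts can be normalised there: this is the initial value of the
   lift whose final coordinate over [U v] is 0. *)
exists (fun y => q y 0 - s y 1 v) => y u Uu.
have := sloc y u v; rewrite H0 H1 => /(_ Uu Uv).
apply: filterS => y' /(congr1 -%R).
by rewrite !opprB /s !H0 ![q _ 0 - _ + _]addrAC.
Unshelve. all: by end_near.
Qed.

End Monodromy.

(** * Cocycles on contractible complexes *)

Lemma ptws_cvg (T : Type) (Z : topologicalType) (F : set_system (T -> Z)) (f : T -> Z) :
  Filter F -> (forall t, (fun g => g t) @ F --> f t) -> {ptws, F --> f}.
Proof.
move=> FF Ff; apply/cvg_sup => i.
rewrite cvg_image; last by rewrite eqEsubset; split=> v // _; exists (cst v).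
move=> W /= Q; rewrite nbhs_simpl; exists (@^~ i @^-1` W); first exact: Ff.
by rewrite eqEsubset; split => [j [? + <-//]|j Wj]; exists (fun _ => j).
Qed.

Section Realizations.
Variables (R : realType) (V : choiceType) (X : simplicial_complex V).
Local Notation Y := (realization R X).

Definition open_star (u : V) : set Y := [set y : Y | 0 < y u].

Lemma open_star_open u : open (open_star u).
Proof.
suff : realization_open (open_star u) by [].
move=> s Xs; exists [set t : {ptws V -> R} | 0 < t u] => //.
rewrite [X in open X](_ : _ = proj u @^-1` [set r : R | 0 < r]) //.
apply: open_comp; last exact: open_gt.
by move=> t _; exact: proj_continuous.
Qed.

Lemma open_star_cover (y : Y) : exists u, open_star u y.
Proof.
have [s Xs [y0 ys sum1]] := baryP y.
apply: contrapT => /forallNP yN.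
have : \sum_(v <- s) y v = 0.
  rewrite big1 // => v _; apply/eqP; rewrite eq_le y0 andbT leNgt.
  by apply/negP; exact: yN.
by rewrite sum1 => /eqP; rewrite oner_eq0.
Qed.

(** The positive coordinates of [y] all lie in one simplex. Through this, relations assumed on
    simplices of [X] become relations on the overlaps of the cover by open stars. *)
Lemma open_star_simplex (y : Y) (s : {fset V}) : s != fset0 ->
  (forall u, u \in s -> open_star u y) -> X s.
Proof.
move=> s0 ys; have [t Xt [_ yt _]] := baryP y.
apply: (simplexS Xt) => //; apply/fsubsetP => u /ys; rewrite /open_star /= => yu.
by apply: contraTT (yu) => /yt ->; rewrite ltxx.
Qed.

Lemma vertex_closed_simplex v :
  exists2 s, X s & closed_simplex s (fun u => (u == v)%:R : R).
Proof.
exists [fset v]%fset; first exact: simplex1.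
split=> [u|u|]; first by rewrite ler0n.
- by rewrite inE => /negPf->.
- by rewrite big_seq_fset1 eqxx.
Qed.

Definition edge_point (v w : V) (r : R) : V -> R :=
  fun u => (1 - r) * (u == v)%:R + r * (u == w)%:R.

Lemma edge_point_closed_simplex (v w : V) (r : R) : v != w -> 0 <= r <= 1 ->
  closed_simplex [fset v; w]%fset (edge_point v w r).
Proof.
move=> vw /andP[r0 r1]; rewrite /edge_point; split.
- by move=> u; rewrite addr_ge0 // mulr_ge0 // subr_ge0.
- by move=> u; rewrite !inE => /norP[/negPf-> /negPf->]; rewrite !mulr0 addr0.
- rewrite big_fsetU1 ?inE //= big_seq_fset1 !eqxx (negPf vw) eq_sym (negPf vw).
  by rewrite !mulr0 !mulr1 addr0 add0r subrK.
Qed.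

Lemma edge_path (v w : V) : v != w -> X [fset v; w]%fset ->
  exists e : R -> Y, (forall r : R, 0 <= r <= 1 -> e r = edge_point v w r :> (V -> R)) /\
    continuous_path R Y e.
Proof.
move=> vw Xvw.
have pe r : exists y : Y, 0 <= r <= 1 -> bary y = edge_point v w r.
  have ex s : 0 <= s <= 1 -> exists y : Y, bary y = edge_point v w s.
    move=> s01; have P : exists2 t, X t & closed_simplex t (edge_point v w s).
      by exists [fset v; w]%fset => //; exact: edge_point_closed_simplex.
    by exists (Realization P).
  have [/ex[y Hy]|_] := boolP (0 <= r <= 1); first by exists y.
  by have [|y _] := ex 0; [rewrite lexx ler01|exists y].
have [e He] := choice pe; exists e; split=> // t O t01 oO Ot.
(* The path stays in one closed simplex, on which [O] is the trace of a set open for pointwise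
   convergence, so continuity of the coordinates is enough. *)
have : realization_open O by [].
move=> /(_ _ Xvw)[Q oQ OQ].
have cs r : 0 <= r <= 1 -> closed_simplex [fset v; w]%fset (e r).
  by move=> r01; rewrite He //; exact: edge_point_closed_simplex.
have Qt : Q (edge_point v w t) by rewrite -He //; apply/(OQ _ (cs t t01)).
have cvg_e : {ptws, edge_point v w @ t --> edge_point v w t}.
  have FF : Filter (edge_point v w @ t) by exact: fmap_filter.
  apply: (ptws_cvg _ _ _ _ FF) => u.
  have : (1 - r) * (u == v)%:R + r * (u == w)%:R @[r --> t] -->
      (1 - t) * (u == v)%:R + t * (u == w)%:R.
    apply: cvgD; apply: cvgMr_tmp; last exact: cvg_id.
    by apply: cvgB; [exact: cvg_cst|exact: cvg_id].
  exact.
have /nbhs_ballP[d /= d0 Hd] : nbhs t (edge_point v w @^-1` Q).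
  by apply: cvg_e; exact: open_nbhs_nbhs.
exists d => // t' t01' tt'; apply/(OQ _ (cs t' t01')); rewrite He //.
by apply: Hd; rewrite /ball /= distrC.
Qed.

Lemma contraction_cont (H : Y * R -> Y) :
  {within setT `*` `[0, 1]%classic, continuous H} ->
  forall y t (O : set Y), 0 <= t <= 1 -> open O -> O (H (y, t)) ->
  exists2 e, 0 < e & exists2 N, nbhs y N &
    forall y' t', N y' -> 0 <= t' <= 1 -> `|t' - t| < e -> O (H (y', t')).
Proof.
move=> /subspace_continuousP Hc y t O t01 oO Ot.
have At : (setT `*` `[0, 1]%classic) (y, t) by split=> //=; rewrite in_itv.
have := Hc _ At O; rewrite nbhs_simpl /= => /(_ (open_nbhs_nbhs (conj oO Ot))).
rewrite /within /= => -[[/= N M] [/= Ny /nbhs_ballP[e /= e0 He]] NM].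
exists e => //; exists N => // y' t' Ny' t01' tt'.
apply: (NM (y', t')); last by split=> //=; rewrite in_itv.
by split=> //=; apply: He; rewrite /ball /= distrC.
Qed.

Hypothesis contrX : contractible R Y.

(** Attach to each point [y] a vertex [k y] whose open star contains it. Any two such vertices are
    equal or adjacent, so [c (k y)] does not depend on the choice and is locally constant along the
    path from [y] to [y0]. *)
Lemma contractible_connected (A : Type) (c : V -> A) :
  (forall v w, X [fset v; w]%fset -> c v = c w) -> forall v w, c v = c w.
Proof.
move=> ccst.
have [y0 [H [Hc H0 H1]]] := contrX.
have [k Hk] := choice open_star_cover.
have kstar (y : Y) u : open_star u y -> c (k y) = c u.
  move=> uy; apply: ccst; apply: (@open_star_simplex y).
    by apply/fset0Pn; exists u; rewrite !inE eqxx orbT.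
  by move=> x; rewrite !inE => /orP[]/eqP->.
have ky y : c (k y) = c (k y0).
  rewrite -(H0 y) -(H1 y).
  apply: (@locally_constant_segment R A (fun t => c (k (H (y, t))))) => // t t01.
  have [e e0 [N Ny He]] :=
    contraction_cont H Hc y t _ t01 (open_star_open (k (H (y, t)))) (Hk _).
  exists e => // t' t01' tt'; apply: kstar; apply: He => //; exact: nbhs_singleton.
suff cv v : c v = c (k y0) by move=> v w; rewrite !cv.
by rewrite -(ky (Realization (vertex_closed_simplex v))); apply/esym/kstar; rewrite /open_star /= eqxx.
Qed.

(** The cocycle [f] is a family of transition functions for the cover by open stars: by the cocycle
    identity the coordinates [f (k y) u] change by [f u u'], whatever the choice of [k]. Monodromy
    gives a locally constant section, and [F v] is its coordinate over the star of [v] at the vertex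
    [v]. *)
Lemma contractible_primitive (A : zmodType) (f : V -> V -> A) :
  (forall u v w, X [fset u; v; w]%fset -> f u v + f v w = f u w) ->
  exists F : V -> A, forall v w, X [fset v; w]%fset -> f v w = F w - F v.
Proof.
move=> fcocycle.
have [y0 [H [Hc H0 H1]]] := contrX.
have [k Hk] := choice open_star_cover.
pose G u (y : Y) := f (k y) u.
have GE u u' y : open_star u y -> open_star u' y -> G u' y - G u y = f u u'.
  move=> uy uy'; rewrite /G -(fcocycle (k y) u u') 1?addrC ?addKr //.
  apply: (@open_star_simplex y).
    by apply/fset0Pn; exists u'; rewrite !inE eqxx orbT.
  by move=> x; rewrite !inE => /orP[/orP[]|]/eqP->.
have Gtr u u' : exists c, forall y, open_star u y -> open_star u' y ->
    G u' y - G u y = c by exists (f u u') => y; exact: GE.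
have [q Hq] := contraction_section R Y V A open_star G open_star_open
  open_star_cover Gtr y0 H (contraction_cont H Hc) H0 H1.
pose pt v := Realization (vertex_closed_simplex v).
exists (fun v => q (pt v) + G v (pt v)) => v w Xvw.
have [<-|vw] := eqVneq v w.
  rewrite subrr; apply/eqP; rewrite -[eqbLHS]addr0 -(addrN (f v v)) addrA.
  rewrite fcocycle ?subrr //.
  have -> : [fset v; v; v]%fset = [fset v]%fset.
    by apply/fsetP => x; rewrite !inE !orbb.
  exact: simplex1.
have [e [eE ec]] := edge_path _ _ vw Xvw.
have bary_inj (y y' : Y) : bary y = bary y' -> y = y'.
  case: y y' => [y Py] [y' Py'] /= yy'; subst y'.
  by congr Realization; exact: Prop_irrelevance.
have e0 : e 0 = pt v.
  apply: bary_inj; rewrite eE ?lexx ?ler01 //; apply/funext => u /=.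
  by rewrite /edge_point subr0 mul1r mul0r addr0.
have e1 : e 1 = pt w.
  apply: bary_inj; rewrite eE ?lexx ?ler01 //; apply/funext => u /=.
  by rewrite /edge_point subrr mul1r mul0r add0r.
have qconst u (a b : R) : 0 <= a -> a <= b -> b <= 1 ->
    (forall r : R, a <= r <= b -> open_star u (e r)) ->
    q (e a) + G u (e a) = q (e b) + G u (e b).
  move=> a0 ab b1 Uab.
  apply: (@locally_constant_segment R A (fun t => q (e t) + G u (e t))) => // t tab.
  have t01 : 0 <= t <= 1 by case/andP: tab => ? ?; apply/andP; split; lra.
  have : nbhs (e t) [set y | q y + G u y = q (e t) + G u (e t)].
    exact: Hq (Uab _ tab).
  rewrite nbhsE => -[N [oN Nt] NP].
  have [d d0 Hd] := ec t N t01 oN Nt; exists d => // t' /andP[? ?] tt'.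
  by apply: NP; apply: Hd => //; apply/andP; split; lra.
(* The section has constant coordinate over the star of [v] on the first half of the edge and over
   the star of [w] on the second; at the midpoint both charts apply and differ by [f v w]. *)
have Uv (r : R) : 0 <= r <= 1 / 2 -> open_star v (e r).
  move=> /andP[? ?]; rewrite /open_star /= eE; last by apply/andP; split; lra.
  by rewrite /edge_point eqxx (negPf vw) mulr1 mulr0; lra.
have Uw (r : R) : 1 / 2 <= r <= 1 -> open_star w (e r).
  move=> /andP[? ?]; rewrite /open_star /= eE; last by apply/andP; split; lra.
  by rewrite /edge_point eqxx eq_sym (negPf vw) mulr1 mulr0; lra.
have -> : q (pt v) + G v (pt v) = q (e (1 / 2)) + G v (e (1 / 2)).
  by rewrite -e0; apply: qconst => //; lra.
have -> : q (pt w) + G w (pt w) = q (e (1 / 2)) + G w (e (1 / 2)).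
  by rewrite -e1; apply/esym/qconst => //; lra.
rewrite opprD addrACA subrr add0r; apply/esym/GE.
- by apply: Uv; apply/andP; split; lra.
- by apply: Uw; apply/andP; split; lra.
Qed.

End Realizations.

(** * The open mapping theorem for seminormed subspaces *)

Lemma le0_geometric (R : realType) (a K : R) :
  (forall n, a <= K * 2^-1 ^+ n) -> a <= 0.
Proof.
move=> aK; have : K * 2^-1 ^+ n @[n --> \oo] --> (K * 0 : R).
  apply: cvgMl_tmp; apply: cvg_expr; rewrite ger0_norm ?invr_ge0 //.
  by rewrite invf_lt1 ?ltr1n.
rewrite mulr0 => /cvg_lim <- //; apply: limr_ge.
  by apply/cvg_ex; exists (K * 0); apply: cvgMl_tmp; apply: cvg_expr;
    rewrite ger0_norm ?invr_ge0 // invf_lt1 ?ltr1n.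
by near=> n.
Unshelve. all: by end_near.
Qed.

(** Cochain spaces occur as subspaces [X] of spaces of all functions, and [N] sees only the values
    on orbit representatives. Hence [N] is a seminorm on [M], and equations obtained by limits take
    the form that a seminorm vanishes. *)
Record seminormed_subspace (R : realType) (M : lmodType R) (X : set M)
    (N : M -> R) : Prop := SeminormedSubspace {
  snsub0 : X 0;
  snsubD : forall x y, X x -> X y -> X (x + y);
  snsubZ : forall a x, X x -> X (a *: x);
  snormD : forall x y, N (x + y) <= N x + N y;
  snormZ : forall a x, N (a *: x) = `|a| * N x }.

(* Completeness, in the form in which it is used: [z] converges to [y] when its
   increments are dominated by a sequence [r] that halves at each step. *)
Definition seminorm_complete (R : realType) (M : lmodType R) (X : set M)
    (N : M -> R) : Prop :=
  forall (z : nat -> M) (r : nat -> R), (forall n, X (z n)) ->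
    (forall n, N (z n.+1 - z n) <= r n) -> (forall n, r n.+1 <= r n / 2) ->
    exists2 y, X y & forall n, N (y - z n) <= 2 * r n.

Section Seminorm.
Variables (R : realType) (M : lmodType R) (X : set M) (N : M -> R).
Hypothesis XN : seminormed_subspace R M X N.

Lemma snsubN x : X x -> X (- x).
Proof. by rewrite -scaleN1r; exact: snsubZ XN _ _. Qed.

Lemma snsubB x y : X x -> X y -> X (x - y).
Proof. by move=> Xx Xy; apply: (snsubD _ _ _ _ XN) => //; exact: snsubN. Qed.

Lemma snorm0 : N 0 = 0.
Proof. by rewrite -(scale0r 0) (snormZ _ _ _ _ XN) normr0 mul0r. Qed.

Lemma snormN x : N (- x) = N x.
Proof. by rewrite -scaleN1r (snormZ _ _ _ _ XN) normrN1 mul1r. Qed.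

Lemma snormB x y : N (x - y) <= N x + N y.
Proof. by rewrite -(snormN y); exact: snormD XN _ _. Qed.

Lemma snorm_ge0 x : 0 <= N x.
Proof. by have := snormB x x; rewrite subrr snorm0; lra. Qed.

Lemma snorm_triangle y x z : N (x - z) <= N (x - y) + N (y - z).
Proof. by have := snormD _ _ _ _ XN (x - y) (y - z); rewrite addrA subrK. Qed.

Lemma snormC x y : N (x - y) = N (y - x).
Proof. by rewrite -snormN opprB. Qed.

End Seminorm.

Section OpenMapping.
Variables (R : realType) (M1 M2 : lmodType R).
Variables (X1 : set M1) (N1 : M1 -> R) (X2 : set M2) (N2 : M2 -> R).
Variables (T : M1 -> M2) (B : R).
Hypotheses (s1 : seminormed_subspace R M1 X1 N1).
Hypotheses (s2 : seminormed_subspace R M2 X2 N2).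
Hypotheses (c1 : seminorm_complete R M1 X1 N1) (Tlin : linear T).
Hypothesis Tbound : forall x, X1 x -> N2 (T x) <= B * N1 x.

Let TB x y : T (x - y) = T x - T y.
Proof. by rewrite addrC -scaleN1r Tlin scaleN1r addrC. Qed.

Let T0 : T 0 = 0.
Proof. by rewrite -(subrr 0) TB subrr. Qed.

Let TD x y : T (x + y) = T x + T y.
Proof. by rewrite -[x]scale1r Tlin !scale1r. Qed.

Let TZ a x : T (a *: x) = a *: T x.
Proof. by rewrite -[a *: x]addr0 Tlin T0 addr0. Qed.

(** Each correction halves the residual, so the corrections decrease geometrically and sum to at
    most twice the first bound. The set [Z] of admissible residuals is a parameter: it is the whole
    target in the open mapping theorem, and the cocycles of the deformed representation in the final
    iteration. *)
Lemma successive_approximation (Z : set M2) (C : R) :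
  (forall z x, Z z -> X1 x -> Z (z - T x)) ->
  (forall z, Z z -> exists x, [/\ X1 x, N1 x <= C * N2 z &
     N2 (z - T x) <= N2 z / 2]) ->
  forall z, Z z -> exists x, [/\ X1 x, N1 x <= 2 * (C * N2 z) & N2 (z - T x) = 0].
Proof.
move=> ZT ZA z Zz.
have [A HA] : exists A : M2 -> M1, forall z, Z z -> [/\ X1 (A z),
    N1 (A z) <= C * N2 z & N2 (z - T (A z)) <= N2 z / 2].
  have /choice[A HA] : forall z, exists x, Z z -> [/\ X1 x, N1 x <= C * N2 z &
    N2 (z - T x) <= N2 z / 2].
    move=> y; have [/ZA[x Hx]|nZ] := pselect (Z y); first by exists x.
    by exists 0 => /nZ.
  by exists A.
have C0 : 0 <= C * N2 z.
  have [_ + _] := HA z Zz; apply: le_trans; exact: snorm_ge0 s1 _.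
pose s n := iter n (fun s => s + A (z - T s)) 0.
have sS n : s n.+1 = s n + A (z - T (s n)) by [].
have Xs n : X1 (s n).
  elim: n => [|n IH]; first exact: snsub0 s1.
  by rewrite sS; apply: (snsubD _ _ _ _ s1) => //; have [] := HA _ (ZT _ _ Zz IH).
have Zs n : Z (z - T (s n)) by exact: ZT.
have Ns n : N2 (z - T (s n)) <= N2 z * 2^-1 ^+ n.
  elim: n => [|n IH]; first by rewrite /= T0 subr0 mulr1.
  have [_ _] := HA _ (Zs n); rewrite sS TD opprD addrA => /le_trans; apply.
  by rewrite exprSr mulrA ler_wpM2r // invr_ge0.
have [||x Xx Hx] := c1 s (fun n => C * N2 z * 2^-1 ^+ n) Xs.
- move=> n; rewrite sS addrAC subrr add0r.
  have [_ + _] := HA _ (Zs n) => /le_trans; apply.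
  (* Only the product [C * N2 z] is known to be nonnegative. This gives the sign of [C] unless
     [N2 z] vanishes, and then every residual vanishes too. *)
  have [N0|N0] := eqVneq (N2 z) 0.
    have -> : N2 (z - T (s n)) = 0.
      apply: le_anti; rewrite (snorm_ge0 _ _ _ _ s2) andbT.
      by have := Ns n; rewrite N0 mul0r.
    by rewrite N0 mulr0 mul0r.
  rewrite -mulrA ler_wpM2l //; have := snorm_ge0 _ _ _ _ s2 z.
  by rewrite le_eqVlt eq_sym (negPf N0) /= => N0'; rewrite -(pmulr_lge0 _ N0').
- by move=> n; rewrite exprSr mulrA.
exists x; split=> //.
  by have := Hx 0; rewrite subr0 expr0 mulr1.
apply: le_anti; rewrite (snorm_ge0 _ _ _ _ s2) andbT.
apply: (@le0_geometric _ _ (N2 z + `|B| * (2 * (C * N2 z)))) => n.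
rewrite mulrDl; apply: le_trans (snorm_triangle _ _ _ _ s2 (T (s n)) _ _) _.
apply: lerD => //; rewrite -TB.
apply: le_trans (Tbound _ (snsubB _ _ _ _ s1 _ _ (Xs n) Xx)) _.
rewrite (snormC _ _ _ _ s1) -!mulrA.
apply: le_trans (_ : `|B| * N1 (x - s n) <= _).
  by rewrite ler_wpM2r ?ler_norm // (snorm_ge0 _ _ _ _ s1).
by rewrite ler_wpM2l // mulrA; have := Hx n; rewrite !mulrA.
Qed.

Hypotheses (c2 : seminorm_complete R M2 X2 N2) (TX : forall x, X1 x -> X2 (T x)).
Hypothesis Tonto : forall z, X2 z -> exists2 x, X1 x & T x = z.

(* Otherwise there is a nested sequence of balls in [X2], the [n]-th one avoiding
   the image of the ball of radius [n] of [X1]; their common point is not in the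
   image of [T]. *)
Lemma almost_open_at : exists n : nat, exists z0 r, [/\ X2 z0, 0 < r &
  forall z eta, X2 z -> N2 (z - z0) <= r -> 0 < eta ->
    exists x, [/\ X1 x, N1 x <= n%:R & N2 (z - T x) <= eta]].
Proof.
apply: contrapT => noball.
(* One step of the nested balls. The factor 2 in the last clause matches the distance [2 * r n] to
   the limit in [seminorm_complete], so the limit still avoids the image; the pair [(0, 0)] is a
   default. *)
have /choice[f Hf] : forall a : nat * (M2 * R), exists q : M2 * R,
    X2 a.2.1 -> 0 < a.2.2 -> [/\ X2 q.1, 0 < q.2, q.2 <= a.2.2 / 2,
      N2 (q.1 - a.2.1) <= a.2.2 &
      forall x, X1 x -> N1 x <= a.1%:R -> 2 * q.2 < N2 (q.1 - T x)].
  move=> [n [z0 r]] /=; have [X0|X0] := pselect (X2 z0); last by exists (0, 0).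
  have [r0|r0] := ltP 0 r; last by exists (0, 0).
  apply: contrapT => noq; apply: noball; exists n, z0, r; split=> // z eta Xz zr e0.
  apply: contrapT => nox; apply: noq; exists (z, Num.min (r / 2) (eta / 2)) => _ _.
  split=> //=.
  - by rewrite lt_min !divr_gt0.
  - by rewrite ge_min lexx.
  - move=> x Xx Nx; rewrite ltNge; apply/negP => Nz; apply: nox; exists x; split=> //.
    apply: le_trans Nz _; rewrite mulrC -ler_pdivlMr //.
    by rewrite ge_min lexx orbT.
pose p := fix p n := if n is n'.+1 then f (n', p n') else (0 : M2, 1 : R).
have Hp n : X2 (p n).1 /\ 0 < (p n).2.
  elim: n => [|n [Xp p0]] /=; first by split=> //; exact: snsub0 s2.
  by have [] := Hf (n, p n) Xp p0.
have Hp' n : [/\ (p n.+1).2 <= (p n).2 / 2, N2 ((p n.+1).1 - (p n).1) <= (p n).2 &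
    forall x, X1 x -> N1 x <= n%:R -> 2 * (p n.+1).2 < N2 ((p n.+1).1 - T x)].
  by have [Xp p0] := Hp n; have [_ _] := Hf (n, p n) Xp p0.
have [|||y Xy Hy] := c2 (fun n => (p n).1) (fun n => (p n).2).
- by move=> n; have [] := Hp n.
- by move=> n; have [] := Hp' n.
- by move=> n; have [] := Hp' n.
have [x Xx Txy] := Tonto _ Xy.
have [n Nn] : exists n : nat, N1 x <= n%:R.
  by exists (Num.truncn (N1 x)).+1; apply/ltW/truncnS_gt.
have [_ _ /(_ x Xx Nn)] := Hp' n; rewrite Txy (snormC _ _ _ _ s2) ltNge.
by rewrite (Hy n.+1).
Qed.

(** The ball provided by [almost_open_at] has an arbitrary centre [z0]. Subtracting approximate
    preimages of two points of that ball removes the centre, and scaling gives an approximate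
    preimage of any [z] with relative error one half. *)
Lemma open_mapping : exists2 C, 0 <= C & forall z, X2 z ->
  exists x, [/\ X1 x, N1 x <= C * N2 z & N2 (z - T x) = 0].
Proof.
have [n [z0 [r [X0 r0 Hr]]]] := almost_open_at.
(* Two preimages of seminorm at most [n], scaled by [N2 z / r]. *)
pose C := 2 * n%:R / r.
have C0 : 0 <= C by rewrite /C divr_ge0 ?mulr_ge0 // ltW.
exists (2 * C); first by rewrite mulr_ge0.
move=> z Xz; rewrite -mulrA; move: z Xz; apply: successive_approximation.
  by move=> z x Xz Xx; apply: (snsubB _ _ _ _ s2) => //; exact: TX.
move=> z Xz; have [N0|Nn0] := eqVneq (N2 z) 0.
  exists 0; split; first exact: snsub0 s1.
    by rewrite (snorm0 _ _ _ _ s1) N0 mulr0.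
  by rewrite T0 subr0 N0 mul0r.
have Npos : 0 < N2 z by rewrite lt_neqAle eq_sym Nn0 (snorm_ge0 _ _ _ _ s2).
pose a := r / N2 z; have a0 : 0 < a by rewrite divr_gt0.
(* Two errors of [r / 4] add up to [r / 2], which scales to [N2 z / 2]. *)
have [|||x1 [X1x1 Nx1 Tx1]] := Hr (a *: z + z0) (r / 4).
- by apply: (snsubD _ _ _ _ s2) => //; exact: (snsubZ _ _ _ _ s2).
- by rewrite addrK (snormZ _ _ _ _ s2) gtr0_norm // /a divfK.
- by rewrite divr_gt0.
have [|||x2 [X1x2 Nx2 Tx2]] := Hr z0 (r / 4).
- exact: X0.
- by rewrite subrr (snorm0 _ _ _ _ s2) ltW.
- by rewrite divr_gt0.
exists (a^-1 *: (x1 - x2)); split.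
- by apply: (snsubZ _ _ _ _ s1); exact: (snsubB _ _ _ _ s1).
- rewrite (snormZ _ _ _ _ s1) gtr0_norm ?invr_gt0 // /a invf_div /C.
  rewrite -[leLHS]mulrA [leRHS]mulrC ler_wpM2l ?(ltW Npos) //.
  rewrite mulrC ler_wpM2r ?invr_ge0 ?(ltW r0) //.
  by apply: le_trans (snormB _ _ _ _ s1 _ _) _; lra.
- have -> : z - T (a^-1 *: (x1 - x2)) =
      a^-1 *: ((a *: z + z0 - T x1) - (z0 - T x2)).
    rewrite -{1}[z](scalerK (lt0r_neq0 a0)) TZ TB -scalerBr; congr (_ *: _).
    rewrite !opprB [a *: z + z0 - _]addrAC [RHS]addrACA subrr addr0.
    by rewrite [T x2 - _]addrC addrA.
  rewrite (snormZ _ _ _ _ s2) gtr0_norm ?invr_gt0 // /a invf_div.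
  rewrite -mulrA ler_wpM2l ?(ltW Npos) // mulrC ler_pdivrMr //.
  by apply: le_trans (snormB _ _ _ _ s2 _ _) _; lra.
Qed.

End OpenMapping.

(** * Deformations of representations *)

Section Deformations.
Variables (R : realType) (G : groupType) (E : completeNormedModType R).
Implicit Types pi rho : representation G E.

Lemma rep_bound pi g : exists2 M, 0 < M & forall v, `|pi g v| <= M * `|v|.
Proof.
have := @continuous_linear_bounded R E E 0 (pi g) (@rep_continuous _ _ _ pi g 0).
by move=> /linear_boundedP /pinfty_ex_gt0[M M0 HM]; exists M.
Qed.

(** A supremum bounds its set only if the set is bounded above; the operator bounds of [pi s] and
    [rho s] ensure this. *)
Lemma eps_deformation_norm (S : {fset G}) eps pi rho s v :
  eps_deformation S eps pi rho -> s \in S -> `|pi s v - rho s v| <= eps * `|v|.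
Proof.
move=> def sS; have [->|v0] := eqVneq v 0.
  by rewrite (linear0 (pi s)) (linear0 (rho s)) subrr normr0 mulr0.
have nv0 : 0 < `|v| by rewrite normr_gt0.
have [M M0 HM] := rep_bound pi s; have [M' M0' HM'] := rep_bound rho s.
rewrite -ler_pdivrMr //; apply: le_trans (def s sS).
apply: (ub_le_sup (E := [set `|pi s v - rho s v| | v in [set v | `|v| <= 1]])).
  exists (M + M') => _ [w /= w1 <-]; apply: le_trans (ler_normB _ _) _.
  apply: lerD; [apply: le_trans (HM w) _|apply: le_trans (HM' w) _].
  - by rewrite -[leRHS]mulr1 ler_wpM2l // ltW.
  - by rewrite -[leRHS]mulr1 ler_wpM2l // ltW.
have nV : `| `|v|^-1 | = `|v|^-1 by rewrite ger0_norm // invr_ge0.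
exists (`|v|^-1 *: v) => /=; first by rewrite normrZ nV mulVf ?gt_eqF.
by rewrite (linearZZ (pi s)) (linearZZ (rho s)) -scalerBr normrZ nV mulrC.
Qed.

(** The elements [g] for which the claim holds for every [d] form a subgroup containing [S]. The
    delicate case is a quotient of two elements: the norm of [rho h^-1] is not given and has to be
    bounded uniformly in [rho]. *)
Lemma deformation_close (S : {fset G}) pi g d : generates S -> 0 < d ->
  exists2 eps, 0 < eps & forall rho, eps_deformation S eps pi rho ->
    forall v, `|pi g v - rho g v| <= d * `|v|.
Proof.
move=> hS d0.
pose close g := forall d : R, 0 < d -> exists2 eps : R, 0 < eps &
  forall rho, eps_deformation S eps pi rho ->
    forall v, `|pi g v - rho g v| <= d * `|v|.
suff : g \in [pred g | `[< close g >]] by move=> gH; exact: (asboolW gH).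
apply: hS => {g d d0}; last first.
  move=> s sS; apply: asboolT => d d0; exists d => // rho def v.
  exact: eps_deformation_norm def sS.
split.
  apply: asboolT => d d0; exists 1 => // rho _ v.
  by rewrite !rep1 subrr normr0 mulr_ge0 // ltW.
move=> g h gH hH; have Hg := asboolW gH; have Hh := asboolW hH.
apply: asboolT => d d0.
have [Mg Mg0 HMg] := rep_bound pi g.
have [M M0 HM] := rep_bound pi h^-1.
(* The factor [2 * M] will bound [rho h^-1], and [1 + Mg * M] collects the errors made in [g] and in
   [h^-1]. Below, [e <= (2 * M)^-1] serves the absorption and [e <= d / c] the final estimate. *)
pose c := 2 * M * (1 + Mg * M).
have c0 : 0 < c by rewrite !mulr_gt0 ?addr_gt0 ?mulr_gt0.
pose e := Num.min (2 * M)^-1 (d / c).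
have e0 : 0 < e by rewrite lt_min invr_gt0 mulr_gt0 //= divr_gt0.
have eM : M * e <= 2^-1.
  rewrite -ler_pdivlMl // mulrC -invfM /e ge_min [X in X^-1]mulrC.
  by rewrite mulrC lexx.
have ec : e * c <= d by rewrite -ler_pdivlMr // /e ge_min lexx orbT.
have [eg eg0 Deg] := Hg e e0; have [eh eh0 Deh] := Hh e e0.
exists (Num.min eg eh); first by rewrite lt_min eg0.
move=> rho def v; rewrite !repM.
have {}Deg w : `|pi g w - rho g w| <= e * `|w|.
  by apply: Deg => s /def /le_trans; apply; rewrite ge_min lexx.
have {}Deh w : `|pi h w - rho h w| <= e * `|w|.
  by apply: Deh => s /def /le_trans; apply; rewrite ge_min lexx orbT.
pose y := rho h^-1%g v.
have rhoy : rho h y = v by rewrite /y -repM mulgV rep1.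
have piy w : pi h^-1%g (pi h w) = w by rewrite -repM mulVg rep1.
(* Write [y] as [pi h^-1] applied to [(pi h y - rho h y) + v]. The first term contributes at most
   half of the norm of [y], which is absorbed on the left. *)
have y2M : `|y| <= 2 * M * `|v|.
  have : `|y| <= M * (e * `|y| + `|v|).
    rewrite -{1}(piy y); apply: le_trans (HM _) _; rewrite ler_pM2l //.
    by rewrite -[pi h y](subrK v) -{1}rhoy (le_trans (ler_normD _ _)) ?lerD2r.
  have : M * e * `|y| <= 2^-1 * `|y| by rewrite ler_wpM2r.
  rewrite mulrDr mulrA; lra.
have kE : `|pi h^-1%g v - y| <= M * (e * `|y|).
  rewrite -{1}(piy y) -linearB; apply: le_trans (HM _) _; rewrite ler_pM2l //.
  by rewrite -{1}rhoy distrC.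
have -> : pi g (pi h^-1%g v) - rho g y =
    pi g (pi h^-1%g v - y) + (pi g y - rho g y) by rewrite linearB addrA subrK.
apply: le_trans (ler_normD _ _) _.
apply: le_trans (lerD (HMg _) (Deg _)) _.
apply: le_trans (_ : e * c * `|v| <= _); last by rewrite ler_wpM2r.
apply: le_trans (_ : Mg * (M * (e * `|y|)) + e * `|y| <= _).
  by rewrite lerD2r ler_pM2l.
have -> : Mg * (M * (e * `|y|)) + e * `|y| = e * (1 + Mg * M) * `|y| by ring.
have -> : e * c * `|v| = e * (1 + Mg * M) * (2 * M * `|v|) by rewrite /c; ring.
by rewrite ler_pM2l // mulr_gt0 // addr_gt0 // mulr_gt0.
Qed.

Lemma deformation_close_seq (S : {fset G}) pi (L : seq G) d :
  generates S -> 0 < d ->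
  exists2 eps, 0 < eps & forall rho, eps_deformation S eps pi rho ->
    forall g v, g \in L -> `|pi g v - rho g v| <= d * `|v|.
Proof.
move=> hS d0; elim: L => [|g L [eps eps0 IH]]; first by exists 1.
have [e e0 He] := deformation_close S pi g d hS d0.
exists (Num.min e eps); first by rewrite lt_min e0.
move=> rho def h v; rewrite inE => /predU1P[->|hL].
  by apply: He => s /def /le_trans; apply; rewrite ge_min lexx.
by apply: IH hL => s /def /le_trans; apply; rewrite ge_min lexx orbT.
Qed.

End Deformations.

(** * Maximum norms over finitely many points and their completeness *)

Section MaxNorm.
Variables (R : realType) (E : completeNormedModType R).

Lemma halving_ge0 (r : nat -> R) : (forall n, r n.+1 <= r n / 2) ->
  (forall n, 0 <= r n) -> forall n, r n <= r 0%N * 2^-1 ^+ n.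
Proof.
move=> rS r0; elim=> [|n IH]; first by rewrite mulr1.
by rewrite (le_trans (rS n)) // exprSr mulrA ler_wpM2r // invr_ge0.
Qed.

Lemma halving_cvg (u : nat -> E) (r : nat -> R) :
  (forall n, `|u n.+1 - u n| <= r n) -> (forall n, r n.+1 <= r n / 2) ->
  exists2 l, u n @[n --> \oo] --> l & forall n, `|l - u n| <= 2 * r n.
Proof.
move=> ur rS; have r0 n : 0 <= r n by exact: le_trans (ur n).
(* Halving gives [r n <= 2 * r n - 2 * r n.+1], so the increments telescope. *)
have udist n k : `|u (n + k)%N - u n| <= 2 * r n - 2 * r (n + k)%N.
  elim: k => [|k IH]; first by rewrite addn0 !subrr normr0.
  rewrite addnS -[_ - u n](subrKA (u (n + k)%N)).
  apply: le_trans (ler_normD _ _) _.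
  by have := ur (n + k)%N; have := rS (n + k)%N; lra.
have udist2 n m : (n <= m)%N -> `|u m - u n| <= 2 * r n.
  by move=> nm; have := udist n (m - n)%N; rewrite subnKC //; have := r0 m; lra.
have r_cvg : r n @[n --> \oo] --> 0.
  apply: (squeeze_cvgr (f := cst 0) (h := fun n => r 0%N * 2^-1 ^+ n)).
  - by near=> n; rewrite r0 /= halving_ge0.
  - exact: cvg_cst.
  - rewrite -[X in _ --> X](mulr0 (r 0%N)); apply: cvgMl_tmp; apply: cvg_expr.
    by rewrite ger0_norm ?invr_ge0 // invf_lt1 ?ltr1n.
have : cvg (u n @[n --> \oo]).
  apply: cauchy_cvg; apply: cauchy_exP => e e0.
  have [n _ /(_ n (leqnn n))] : \forall n \near \oo, r n < e / 2.
    by apply: (cvgr_lt _ r_cvg); rewrite divr_gt0.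
  move=> /= rne; exists (u n); exists n => // m /= nm.
  rewrite -ball_normE /= distrC; apply: le_lt_trans (udist2 _ _ nm) _; lra.
move=> /cvg_ex[l ul]; exists l => // n.
have un : `|u m - u n| @[m --> \oo] --> `|l - u n|.
  by apply: cvg_norm; apply: cvgB => //; exact: cvg_cst.
rewrite -(cvg_lim _ un) //; apply: limr_le; first by apply/cvg_ex; exists `|l - u n|.
by exists n => // m /= nm; exact: udist2.
Unshelve. all: by end_near.
Qed.

Variable I : eqType.
Implicit Types (L : seq I) (f : I -> E).

Definition maxnorm L f : R := \big[Num.max/0]_(i <- L) `|f i|.

Lemma maxnorm_ge L f i : i \in L -> `|f i| <= maxnorm L f.
Proof. by move=> iL; exact: (@le_bigmax_seq _ R I L 0 i xpredT (fun i => `|f i|)). Qed.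

Lemma maxnorm_ge0 L f : 0 <= maxnorm L f.
Proof. by rewrite /maxnorm; elim/big_ind: _ => // x y x0 y0; rewrite le_max x0. Qed.

Lemma maxnorm_le L f r : 0 <= r -> (forall i, i \in L -> `|f i| <= r) ->
  maxnorm L f <= r.
Proof.
move=> r0 Hr; rewrite /maxnorm big_seq; apply: bigmax_le => // i iL; exact: Hr.
Qed.

Lemma maxnorm_seminormed (X : set (I -> E)) L : X 0 ->
  (forall a f g, X f -> X g -> X (a *: f + g)) ->
  seminormed_subspace R (I -> E) X (maxnorm L).
Proof.
move=> X0 XL.
have XZ a f : X f -> X (a *: f) by move=> Xf; rewrite -[_ *: _]addr0; exact: XL.
split=> //.
- by move=> f g Xf Xg; rewrite -[f]scale1r; exact: XL.
- move=> f g; apply: maxnorm_le => [|i iL]; first by rewrite addr_ge0 ?maxnorm_ge0.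
  by apply: le_trans (ler_normD _ _) _; apply: lerD; exact: maxnorm_ge.
- have Zle a f : maxnorm L (a *: f) <= `|a| * maxnorm L f.
    apply: maxnorm_le => [|i iL]; first by rewrite mulr_ge0 ?maxnorm_ge0.
    by rewrite normrZ ler_wpM2l // maxnorm_ge.
  move=> a f; apply: le_anti; rewrite Zle /=.
  have [->|a0] := eqVneq a 0; first by rewrite normr0 mul0r maxnorm_ge0.
  rewrite -ler_pdivlMl ?normr_gt0 // -{1}[f](scalerK a0).
  by apply: le_trans (Zle _ _) _; rewrite normfV.
Qed.

(** On [X] each value is controlled by the values on [L], so a sequence that is Cauchy on [L]
    converges at every point. The constant may depend on the point: off [L] only convergence is
    used, and the rate [2 * r n] is kept on [L]. *)
Lemma maxnorm_complete (X : set (I -> E)) L :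
  seminormed_subspace R (I -> E) X (maxnorm L) ->
  (forall i, exists C, forall f, X f -> `|f i| <= C * maxnorm L f) ->
  (forall (z : nat -> I -> E) y, (forall n, X (z n)) ->
     (forall i, z n i @[n --> \oo] --> y i) -> X y) ->
  seminorm_complete R (I -> E) X (maxnorm L).
Proof.
move=> sX Xbound Xlim z r Xz zr rS.
have r0 n : 0 <= r n by exact: le_trans (maxnorm_ge0 _ _) (zr n).
have /choice[y Hy] : forall i, exists l : E, (z n i @[n --> \oo] --> l) /\ (i \in L -> forall n, `|l - z n i| <= 2 * r n).
  move=> i; have [iL|iL] := boolP (i \in L).
    have [|l zl Hl] := halving_cvg (fun n => z n i) r _ rS.
      by move=> n; apply: le_trans (zr n); exact: maxnorm_ge.
    by exists l.
  have [C HC] := Xbound i.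
  have [||l zl Hl] := halving_cvg (fun n => z n i) (fun n => `|C| * r n).
  - move=> n; apply: le_trans (HC _ (snsubB _ _ _ _ sX _ _ (Xz n.+1) (Xz n))) _.
    apply: le_trans (ler_wpM2r (maxnorm_ge0 _ _) (ler_norm C)) _.
    by rewrite ler_wpM2l.
  - by move=> n; rewrite -mulrA ler_wpM2l.
  by exists l.
exists y; first by apply: (Xlim z) => // i; have [] := Hy i.
move=> n; apply: maxnorm_le => [|i iL]; first by rewrite mulr_ge0.
by have [_ ] := Hy i; exact.
Qed.

Lemma maxnorm_bound (M : Type) (X : set M) (N : M -> R) (T : M -> I -> E) L :
  (forall x, 0 <= N x) ->
  (forall i, exists C, forall x, X x -> `|T x i| <= C * N x) ->
  exists2 B, 0 <= B & forall x, X x -> maxnorm L (T x) <= B * N x.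
Proof.
move=> N0 HT; elim: L => [|i L [B B0 IH]].
  by exists 0 => // x _; rewrite /maxnorm big_nil mul0r.
have [C HC] := HT i; exists (Num.max C B) => [|x Xx]; first by rewrite le_max B0 orbT.
rewrite /maxnorm big_cons ge_max; apply/andP; split.
  by apply: le_trans (HC x Xx) _; rewrite ler_wpM2r // le_max lexx.
by apply: le_trans (IH x Xx) _; rewrite ler_wpM2r // le_max lexx orbT.
Qed.

End MaxNorm.

(** * Equivariant cochains *)

Section Cover.
Variables (R : realType) (G : groupType) (V W : choiceType).
Variables (X : simplicial_complex V) (K : simplicial_complex W).
Variables (p : V -> W) (act : G -> V -> V).

Definition edge (v w : V) : bool := (v != w) && `[< X [fset v; w]%fset >].

Lemma edgeP v w : reflect (v != w /\ X [fset v; w]%fset) (edge v w).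
Proof.
by apply: (iffP andP) => -[vw Xvw]; split=> //; [exact: asboolW|exact: asboolT].
Qed.

Lemma edge_sym v w : edge v w = edge w v.
Proof. by rewrite /edge eq_sym fsetUC. Qed.

Lemma edge_irrefl v : edge v v = false.
Proof. by rewrite /edge eqxx. Qed.

(* [sel w] is a lift of the vertex [w], [tr v] carries the lift of [p v] to [v],
   and [nb w w'] is the neighbour of [sel w] above [w'], or a junk vertex not
   adjacent to [sel w] if [w] and [w'] are not adjacent. *)
Record cover_data (ws : seq W) (sel : W -> V) (tr : V -> G) (nb : W -> W -> V) :
    Prop := CoverData {
  cd_act1 : forall v, act 1%g v = v;
  cd_actM : forall g h v, act (g * h)%g v = act g (act h v);
  cd_free : forall g h v, act g v = act h v -> g = h;
  cd_pact : forall g v, p (act g v) = p v;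
  cd_edge : forall g v w, edge v w -> edge (act g v) (act g w);
  cd_edgep : forall v w, edge v w -> p v != p w;
  cd_ws : forall w, w \in ws;
  cd_sel : forall w, p (sel w) = w;
  cd_tr : forall v, act (tr v) (sel (p v)) = v;
  cd_nb : forall w y, edge (sel w) y -> y = nb w (p y);
  cd_pnb : forall w w', edge (sel w) (nb w w') -> p (nb w w') = w' }.

(** Finitely many vertices: singletons belong to the finite 2-skeleton. Simple transitivity on the
    fibres gives [tr] and freeness, and uniqueness of lifts of an edge through a given vertex makes
    [nb] well defined. *)
Lemma cover_dataP : EilenbergMacLane_universal_cover X K R p act ->
  exists ws sel tr nb, cover_data ws sel tr nb.
Proof.
move=> [finK _ [psurj pX plift] [act1 actM actX] fibre].
have [ws wsE] : exists ws : seq W, [set: W] = [set` ws].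
  apply/finite_seqP.
  have -> : [set: W] =
      (fun w => [fset w]%fset) @^-1` [set t | K t /\ (#|` t| <= 3)%N].
    apply/seteqP; split=> // w _ /=; split; first exact: simplex1.
    by rewrite cardfs1.
  by apply: finite_preimage finK => w w' _ _ /fset1_inj.
have /choice[sel selE] := psurj.
have /choice[tr trE] : forall v, exists g, act g (sel (p v)) = v.
  by move=> v; have [/(_ (selE (p v)))[g [Hg _]] _] := fibre (sel (p v)) v; exists g.
have actK g v : act g^-1%g (act g v) = v by rewrite -actM mulVg act1.
have free g h v : act g v = act h v -> g = h.
  move=> gh; have [/(_ erefl)[k [_ kuniq]] _] := fibre v v.
  apply: (mulgI h^-1%g); rewrite mulVg; apply: etrans (_ : k = _).
    by apply/esym/kuniq; rewrite actM gh actK.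
  by apply: kuniq; rewrite act1.
have pact g v : p (act g v) = p v.
  by apply/esym/fibre; exists g; split=> // h /free.
have imfset2 (Z : choiceType) (f : V -> Z) v w :
    [fset f x | x in [fset v; w]]%fset = [fset f v; f w]%fset.
  by rewrite imfsetU !imfset_fset1.
have actI g v w : act g v = act g w -> v = w.
  by move=> gvw; rewrite -(actK g v) gvw actK.
have edgep v w : edge v w -> p v != p w.
  move=> /edgeP[vw Xvw]; apply: contra_neq vw; have [_] := pX _ Xvw.
  by apply; rewrite !inE eqxx ?orbT.
have nb_uniq w y y' : edge (sel w) y -> edge (sel w) y' -> p y = p y' -> y = y'.
  move=> e e' yy'; have [/edgeP[sy Xy] /edgeP[sy' Xy']] := (e, e').
  have [Ky _] := pX _ Xy; have [Ky' _] := pX _ Xy'.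
  have [|t [_ tuniq]] := plift (sel w) _ Ky.
    by rewrite imfset2 !inE eqxx.
  have E : [fset sel w; y]%fset = [fset sel w; y']%fset.
    rewrite -(tuniq [fset sel w; y]%fset); last by split=> //; rewrite !inE eqxx.
    rewrite -(tuniq [fset sel w; y']%fset) //; split=> //.
      by rewrite !inE eqxx.
    by rewrite !imfset2 yy'.
  have : y \in [fset sel w; y']%fset by rewrite -E !inE eqxx orbT.
  by rewrite !inE eq_sym (negPf sy) /= => /eqP.
have /choice[nb nbE] : forall q : W * W, exists y,
    (forall y', edge (sel q.1) y' -> p y' = q.2 -> y' = y) /\
    (edge (sel q.1) y -> p y = q.2).
  move=> [w w'] /=.
  have [[y [ey py]]|noy] := pselect (exists y, edge (sel w) y /\ p y = w').
    by exists y; split=> // y' ey' py'; apply: nb_uniq ey' ey _; rewrite py py'.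
  exists (sel w); rewrite edge_irrefl; split=> // y' ey' py'.
  by case: noy; exists y'.
exists ws, sel, tr, (fun w w' => nb (w, w')); split=> //.
- move=> g v w /edgeP[vw Xvw]; apply/edgeP; split.
    by apply: contra_neq vw; exact: actI.
  by rewrite -imfset2; exact: actX.
- by move=> w; have : [set: W] w by []; rewrite wsE.
- by move=> w y ey; exact: (nbE (w, p y)).1.
- by move=> w w' ew; exact: (nbE (w, w')).2.
Qed.

(** * Equivariant cochains in degrees 0 and 1 and their transfer between representations *)

Section Cochains.
Variables (ws : seq W) (sel : W -> V) (tr : V -> G) (nb : W -> W -> V).
Hypothesis cd : cover_data ws sel tr nb.
Variable E : completeNormedModType R.
Implicit Types (rho pi : representation G E) (c : V -> E) (f : V * V -> E).

Let act1 := cd_act1 _ _ _ _ cd.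
Let actM := cd_actM _ _ _ _ cd.
Let free := cd_free _ _ _ _ cd.
Let pact := cd_pact _ _ _ _ cd.
Let edgep := cd_edgep _ _ _ _ cd.
Let wsP := cd_ws _ _ _ _ cd.
Let selK := cd_sel _ _ _ _ cd.
Let trE := cd_tr _ _ _ _ cd.

Lemma act_edge g v w : edge (act g v) (act g w) = edge v w.
Proof.
apply/idP/idP; last exact: cd_edge cd _ _ _.
by move=> /(cd_edge _ _ _ _ cd g^-1%g); rewrite -!actM mulVg !act1.
Qed.

Lemma tr_act g v : tr (act g v) = (g * tr v)%g.
Proof. by apply: (free _ _ (sel (p v))); have := trE (act g v); rewrite pact actM trE. Qed.

Lemma tr_sel w : tr (sel w) = 1%g.
Proof. by apply: (free _ _ (sel w)); have := trE (sel w); rewrite selK act1. Qed.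

Lemma edge_nb v w : edge v w ->
  edge (sel (p v)) (nb (p v) (p w)) /\ act (tr v) (nb (p v) (p w)) = w.
Proof.
move=> vw; pose y := act (tr v)^-1%g w.
have yw : act (tr v) y = w by rewrite /y -actM mulgV act1.
have ey : edge (sel (p v)) y by rewrite -(act_edge (tr v)) trE yw.
have yE : y = nb (p v) (p w) by rewrite -yw pact; exact: cd_nb cd _ _ ey.
by rewrite -yE.
Qed.

Definition C0 rho : set (V -> E) :=
  [set c | forall g v, c (act g v) = rho g (c v)].

Definition C1 rho : set (V * V -> E) :=
  [set f | [/\ forall v w, ~~ edge v w -> f (v, w) = 0,
     forall v w, f (w, v) = - f (v, w) &
     forall g v w, f (act g v, act g w) = rho g (f (v, w))]].

Definition Z1 rho : set (V * V -> E) :=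
  [set f | C1 rho f /\ forall u v w, X [fset u; v; w]%fset ->
     f (u, v) + f (v, w) = f (u, w)].

Definition d0 (c : V -> E) (q : V * V) : E :=
  if edge q.1 q.2 then c q.2 - c q.1 else 0.

(* An orientation of the edges of [K], hence a [G]-invariant one of the edges
   of [X]. *)
Definition oriented (w w' : W) : bool := (index w ws < index w' ws)%N.

Definition vertex_reps : seq V := map sel ws.

(** Non-adjacent pairs are kept: [nb] is then a junk vertex and every 1-cochain vanishes on the
    pair. *)
Definition edge_reps : seq (V * V) :=
  [seq (sel q.1, nb q.1 q.2) | q <- [seq (w, w') | w <- ws, w' <- ws] &
     oriented q.1 q.2].

Local Notation N0 := (maxnorm R E V vertex_reps).
Local Notation N1 := (maxnorm R E (V * V)%type edge_reps).

(* [transfer0 rho c] is the [rho]-equivariant cochain with the same values as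
   [c] on orbit representatives; similarly for [transfer1]. *)
Definition transfer0 rho (c : V -> E) (v : V) : E := rho (tr v) (c (sel (p v))).

Definition transfer1 rho (f : V * V -> E) (q : V * V) : E :=
  if edge q.1 q.2 then
    if oriented (p q.1) (p q.2)
    then rho (tr q.1) (f (sel (p q.1), nb (p q.1) (p q.2)))
    else - rho (tr q.2) (f (sel (p q.2), nb (p q.2) (p q.1)))
  else 0.

Lemma orientedC w w' : w != w' -> oriented w' w = ~~ oriented w w'.
Proof.
move=> ww'; rewrite /oriented -leqNgt ltn_neqAle; case: eqP => // /(index_inj w).
by move=> /(_ (wsP _) (wsP _)) w'w; rewrite w'w eqxx in ww'.
Qed.

Lemma vertex_repsP v : sel (p v) \in vertex_reps.
Proof. exact: map_f. Qed.

Lemma edge_repsP w w' : oriented w w' -> (sel w, nb w w') \in edge_reps.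
Proof.
move=> oww'; apply/mapP; exists (w, w') => //; rewrite mem_filter oww' /=.
by apply/allpairsP; exists (w, w').
Qed.

Lemma transfer0_C0 rho c : C0 rho (transfer0 rho c).
Proof. by move=> g v; rewrite /transfer0 pact tr_act repM. Qed.

Lemma transfer0_id rho c : C0 rho c -> transfer0 rho c = c.
Proof. by move=> Cc; apply/funext => v; rewrite /transfer0 -Cc trE. Qed.

Lemma transfer0_sel rho c w : transfer0 rho c (sel w) = c (sel w).
Proof. by rewrite /transfer0 tr_sel rep1 selK. Qed.

Lemma transfer0_norm rho c : N0 (transfer0 rho c) = N0 c.
Proof.
rewrite /maxnorm big_map [RHS]big_map.
by apply: eq_bigr => w _; rewrite transfer0_sel.
Qed.

Lemma transfer1_C1 rho f : C1 rho (transfer1 rho f).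
Proof.
split.
- by move=> v w /negPf vw; rewrite /transfer1 /= vw.
- move=> v w; rewrite /transfer1 /= edge_sym.
  have [vw|] := boolP (edge v w); last by rewrite oppr0.
  rewrite (orientedC (p v)) ?edgep //.
  by case: (oriented (p v) (p w)); rewrite //= opprK.
- move=> g v w; rewrite /transfer1 /= act_edge !pact !tr_act !repM.
  by case: edge; [case: oriented; rewrite ?linearN|rewrite linear0].
Qed.

Lemma transfer1_id rho f : C1 rho f -> transfer1 rho f = f.
Proof.
move=> [f0 fN fG]; apply/funext => -[v w]; rewrite /transfer1 /=.
have [vw|/f0->//] := boolP (edge v w).
case: ifP => _.
  by have [_ Ew] := edge_nb v w vw; rewrite -fG trE Ew.
rewrite edge_sym in vw; have [_ Ev] := edge_nb w v vw.
by rewrite -fG trE Ev fN opprK.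
Qed.

Lemma transfer1_reps rho pi f q : C1 rho f -> q \in edge_reps ->
  transfer1 pi f q = f q.
Proof.
move=> [f0 _ _] /mapP[[w w']]; rewrite mem_filter => /andP[/= oww' _] ->.
rewrite /transfer1 /=; have [ew|/f0->//] := boolP (edge _ _).
by rewrite (cd_pnb _ _ _ _ cd _ _ ew) selK oww' tr_sel rep1.
Qed.

(** The value at [v] is [rho (tr v)] applied to the value at a representative. As [rho] need not be
    uniformly bounded, the constant depends on [v]. *)
Lemma C0_bound rho v : exists C, forall c, C0 rho c -> `|c v| <= C * N0 c.
Proof.
have [C C0_ HC] := rep_bound R G E rho (tr v); exists C => c Cc.
rewrite -(transfer0_id rho c Cc); apply: le_trans (HC _) _.
by rewrite ler_pM2l // (transfer0_id rho c Cc) maxnorm_ge // vertex_repsP.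
Qed.

Lemma C1_bound rho q : exists C, forall f, C1 rho f -> `|f q| <= C * N1 f.
Proof.
case: q => v w.
have [Cv Cv0 HCv] := rep_bound R G E rho (tr v).
have [Cw Cw0 HCw] := rep_bound R G E rho (tr w).
exists (Cv + Cw) => f Cf; rewrite -{1}(transfer1_id rho f Cf) /transfer1 /=.
have N1f := maxnorm_ge0 R E _ edge_reps f.
have [vw|] := boolP (edge v w); last first.
  by rewrite normr0 mulr_ge0 // addr_ge0 // ltW.
have [ow|] := boolP (oriented _ _).
  apply: le_trans (HCv _) _; apply: ler_pM; rewrite ?(ltW Cv0) ?lerDl ?(ltW Cw0) //.
  by apply: maxnorm_ge; exact: edge_repsP.
rewrite -orientedC ?edgep // => ow; rewrite normrN.
apply: le_trans (HCw _) _; apply: ler_pM; rewrite ?(ltW Cw0) ?lerDr ?(ltW Cv0) //.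
by apply: maxnorm_ge; exact: edge_repsP.
Qed.

(** Both values come from one vector, by [pi (tr v)] and by [rho (tr v)]; closeness at the single
    element [tr v] is all that is used. *)
Lemma transfer0_close pi rho c v d :
  (forall x, `|pi (tr v) x - rho (tr v) x| <= d * `|x|) -> 0 <= d -> C0 pi c ->
  `|c v - transfer0 rho c v| <= d * N0 c.
Proof.
move=> Hd d0 Cc; rewrite -{1}(transfer0_id pi c Cc); apply: le_trans (Hd _) _.
by rewrite ler_wpM2l // maxnorm_ge // vertex_repsP.
Qed.

Lemma transfer1_close pi rho f v w d :
  (forall x, `|pi (tr v) x - rho (tr v) x| <= d * `|x|) ->
  (forall x, `|pi (tr w) x - rho (tr w) x| <= d * `|x|) -> 0 <= d -> C1 rho f ->
  `|transfer1 pi f (v, w) - f (v, w)| <= d * N1 f.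
Proof.
move=> Hv Hw d0 Cf; rewrite -{2}(transfer1_id rho f Cf) /transfer1 /=.
have N1f := maxnorm_ge0 R E _ edge_reps f.
have [vw|] := boolP (edge v w); last by rewrite subrr normr0 mulr_ge0.
have [ow|] := boolP (oriented _ _).
  apply: le_trans (Hv _) _; rewrite ler_wpM2l //.
  by apply: maxnorm_ge; exact: edge_repsP.
rewrite -orientedC ?edgep // => ow; rewrite -opprD normrN.
apply: le_trans (Hw _) _; rewrite ler_wpM2l //.
by apply: maxnorm_ge; exact: edge_repsP.
Qed.

Lemma C0_lin rho a c c' : C0 rho c -> C0 rho c' -> C0 rho (a *: c + c').
Proof. by move=> Cc Cc' g v; rewrite /= !fctE Cc Cc' linearP. Qed.

Lemma C1_lin rho a f f' : C1 rho f -> C1 rho f' -> C1 rho (a *: f + f').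
Proof.
move=> [f0 fN fG] [f0' fN' fG']; split.
- by move=> v w vw; rewrite !fctE f0 // f0' // scaler0 addr0.
- by move=> v w; rewrite !fctE fN fN' scalerN opprD.
- by move=> g v w; rewrite !fctE fG fG' linearP.
Qed.

Lemma Z1_lin rho a f f' : Z1 rho f -> Z1 rho f' -> Z1 rho (a *: f + f').
Proof.
move=> [Cf Zf] [Cf' Zf']; split; first exact: C1_lin.
move=> u v w Xuvw; rewrite !fctE addrACA -scalerDr.
by rewrite -(Zf _ _ _ Xuvw) -(Zf' _ _ _ Xuvw).
Qed.

Lemma C0_seminormed rho : seminormed_subspace R (V -> E) (C0 rho) N0.
Proof.
apply: maxnorm_seminormed; last exact: C0_lin.
by move=> g v; rewrite linear0.
Qed.

Lemma C1_0 rho : C1 rho 0.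
Proof. by split=> // *; rewrite ?oppr0 ?linear0. Qed.

Lemma C1_seminormed rho : seminormed_subspace R (V * V -> E) (C1 rho) N1.
Proof. apply: maxnorm_seminormed; [exact: C1_0|exact: C1_lin]. Qed.

Lemma Z1_seminormed rho : seminormed_subspace R (V * V -> E) (Z1 rho) N1.
Proof.
apply: maxnorm_seminormed; last exact: Z1_lin.
by split=> [|u v w _]; [exact: C1_0|rewrite addr0].
Qed.

Lemma rep_cvg rho g (u : nat -> E) (l : E) : u n @[n --> \oo] --> l ->
  rho g (u n) @[n --> \oo] --> rho g l.
Proof. move=> ul; apply: continuous_cvg => //; exact: rep_continuous. Qed.

Lemma cvg_eq (u u' : nat -> E) (l l' : E) : u n @[n --> \oo] --> l ->
  u' n @[n --> \oo] --> l' -> (forall n, u n = u' n) -> l = l'.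
Proof.
move=> ul ul' uu'; have E' : u' = u by apply/funext.
by subst u'; exact: (cvg_unique (@norm_hausdorff _ E) ul ul').
Qed.

Lemma C0_complete rho : seminorm_complete R (V -> E) (C0 rho) N0.
Proof.
apply: maxnorm_complete; [exact: C0_seminormed|exact: C0_bound|].
move=> z y Cz zy g v; apply: (cvg_eq _ _ _ _ (zy _) (rep_cvg rho g _ _ (zy v))).
by move=> n; exact: Cz.
Qed.

Lemma C1_limit rho (z : nat -> V * V -> E) y : (forall n, C1 rho (z n)) ->
  (forall q, z n q @[n --> \oo] --> y q) -> C1 rho y.
Proof.
move=> Cz zy; split.
- move=> v w vw; apply: (cvg_eq _ _ _ _ (zy _) (cvg_cst 0)) => n.
  by have [f0 _ _] := Cz n; rewrite f0.
- move=> v w; apply: (cvg_eq _ _ _ _ (zy _) (cvgN (zy _))) => n.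
  by have [_ fN _] := Cz n; rewrite fN.
- move=> g v w; apply: (cvg_eq _ _ _ _ (zy _) (rep_cvg rho g _ _ (zy _))) => n.
  by have [_ _ fG] := Cz n; rewrite fG.
Qed.

Lemma C1_complete rho : seminorm_complete R (V * V -> E) (C1 rho) N1.
Proof.
by apply: maxnorm_complete; [exact: C1_seminormed|exact: C1_bound|exact: C1_limit].
Qed.

Lemma Z1_complete rho : seminorm_complete R (V * V -> E) (Z1 rho) N1.
Proof.
apply: maxnorm_complete; [exact: Z1_seminormed| |].
  by move=> q; have [C HC] := C1_bound rho q; exists C => f [Cf _]; exact: HC.
move=> z y Zz zy; split.
  by apply: C1_limit zy => n; have [] := Zz n.
move=> u v w Xuvw; apply: (cvg_eq _ _ _ _ (cvgD (zy _) (zy _)) (zy _)) => n.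
by have [_ Z] := Zz n; exact: Z.
Qed.

Lemma d0_linear : linear d0.
Proof.
move=> a c c'; apply/funext => q; rewrite !fctE /d0; case: ifP => _.
  by rewrite scalerBr opprD addrACA.
by rewrite scaler0 addr0.
Qed.

Lemma X_sub_edge (s : {fset V}) v w : X s -> v \in s -> w \in s -> v != w -> edge v w.
Proof.
move=> Xs vs ws_ vw; apply/edgeP; split=> //; apply: (simplexS Xs).
  by apply/fsubsetP => x; rewrite !inE => /orP[]/eqP->.
by apply/fset0Pn; exists v; rewrite !inE eqxx.
Qed.

(** The hypothesis is on differences only, so that it also covers orbit maps of affine actions,
    which need not be equivariant for the linear part. *)
Lemma d0_Z1 rho (c : V -> E) :
  (forall g v w, edge v w -> c (act g w) - c (act g v) = rho g (c w - c v)) ->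
  Z1 rho (d0 c).
Proof.
move=> cG; split; first split.
- by move=> v w /negPf vw; rewrite /d0 vw.
- by move=> v w; rewrite /d0 edge_sym; case: ifP; rewrite ?oppr0 //= opprB.
- move=> g v w; rewrite /d0 /= act_edge; case: ifP => vw; last by rewrite linear0.
  exact: cG.
- move=> u v w Xuvw.
  have d0E x y : x \in [fset u; v; w]%fset -> y \in [fset u; v; w]%fset ->
      d0 c (x, y) = c y - c x.
    move=> xs ys; rewrite /d0 /=; have [<-|xy] := eqVneq x y.
      by rewrite edge_irrefl subrr.
    by rewrite (X_sub_edge _ _ _ Xuvw).
  by rewrite !d0E ?inE ?eqxx ?orbT // addrC addrA subrK.
Qed.

Lemma d0_C0_Z1 rho c : C0 rho c -> Z1 rho (d0 c).
Proof. by move=> Cc; apply: d0_Z1 => g v w _; rewrite !Cc linearB. Qed.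

Lemma d0_bound rho : exists2 B, 0 <= B & forall c, C0 rho c ->
  N1 (d0 c) <= B * N0 c.
Proof.
apply: maxnorm_bound; first exact: maxnorm_ge0.
move=> [v w]; have [Cv HCv] := C0_bound rho v; have [Cw HCw] := C0_bound rho w.
exists (`|Cw| + `|Cv|) => c Cc; rewrite /d0 /=; case: ifP => _; last first.
  by rewrite normr0 mulr_ge0 ?addr_ge0 ?maxnorm_ge0.
apply: le_trans (ler_normB _ _) _; rewrite mulrDl; apply: lerD.
  by apply: le_trans (HCw _ Cc) _; rewrite ler_wpM2r ?ler_norm ?maxnorm_ge0.
by apply: le_trans (HCv _ Cc) _; rewrite ler_wpM2r ?ler_norm ?maxnorm_ge0.
Qed.

(** * Alternating cochains and the coboundary from degree 1 to degree 2 *)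

Definition edge_cochain (f : V * V -> E) (s : {ffun 'I_2 -> V}) : E :=
  f (s ord0, s ord_max).

Definition d1 (f : V * V -> E) : {ffun 'I_3 -> V} -> E :=
  coboundary X (edge_cochain f).

Lemma ord2P (i : 'I_2) : i = ord0 \/ i = ord_max.
Proof. by case: i => -[|[|//]] ?; [left|right]; exact: val_inj. Qed.

Let e1 : 'I_3 := @Ordinal 3 1 isT.

Lemma ord3P (i : 'I_3) : [\/ i = ord0, i = e1 | i = ord_max].
Proof.
by case: i => -[|[|[|//]]] ?; [apply: Or31|apply: Or32|apply: Or33]; exact: val_inj.
Qed.

Lemma osimplex1P (s : {ffun 'I_2 -> V}) :
  osimplex X s <-> edge (s ord0) (s ord_max).
Proof.
have -> : osimplex X s <-> injective s /\ X [fset s ord0; s ord_max]%fset.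
  rewrite /osimplex; suff -> : [fset s i | i in 'I_2]%fset =
    [fset s ord0; s ord_max]%fset by [].
  apply/fsetP => y; rewrite !inE; apply/imfsetP/orP => [[i _ ->]|[]/eqP->].
  - by have [->|->] := ord2P i; rewrite eqxx; [left|right].
  - by exists ord0.
  - by exists ord_max.
split=> [[sI Xs]|/edgeP[s01 Xs]].
  by apply/edgeP; split=> //; apply/eqP => /sI.
split=> // i j; have [->|->] := ord2P i; have [->|->] := ord2P j => // /eqP.
- by rewrite (negPf s01).
- by rewrite eq_sym (negPf s01).
Qed.

Lemma osimplex2P (s : {ffun 'I_3 -> V}) : osimplex X s <->
  [/\ s ord0 != s e1, s e1 != s ord_max, s ord0 != s ord_max &
      X [fset s ord0; s e1; s ord_max]%fset].
Proof.
have -> : osimplex X s <-> injective s /\ X [fset s ord0; s e1; s ord_max]%fset.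
  rewrite /osimplex; suff -> : [fset s i | i in 'I_3]%fset =
    [fset s ord0; s e1; s ord_max]%fset by [].
  apply/fsetP => y; rewrite !inE; apply/imfsetP/idP => [[i _ ->]|].
    by have [->|->|->] := ord3P i; rewrite eqxx ?orbT.
  by case/orP => [/orP[]|] /eqP->; [exists ord0|exists e1|exists ord_max].
split=> [[sI Xs]|[n01 n12 n02 Xs]].
  by split=> //; apply/eqP => /sI.
split=> // i j; have [->|->|->] := ord3P i; have [->|->|->] := ord3P j => // /eqP.
- by rewrite (negPf n01).
- by rewrite (negPf n02).
- by rewrite eq_sym (negPf n01).
- by rewrite (negPf n12).
- by rewrite eq_sym (negPf n02).
- by rewrite eq_sym (negPf n12).
Qed.

Definition boundary_value (f : V * V -> E) (u v w : V) : E :=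
  f (v, w) - f (u, w) + f (u, v).

Lemma d1E f s : osimplex X s ->
  d1 f s = boundary_value f (s ord0) (s e1) (s ord_max).
Proof.
move=> os; rewrite /d1 /coboundary; rewrite asboolT //.
rewrite !big_ord_recl big_ord0 addr0 /edge_cochain /face !ffunE.
rewrite expr0 scale1r expr1 scaleN1r /bump /= sqrrN expr1n scale1r addrA.
by congr (f (s _, s _) - f (s _, s _) + f (s _, s _)); exact: val_inj.
Qed.

Lemma d1_out f s : ~ osimplex X s -> d1 f s = 0.
Proof. by move=> os; rewrite /d1 /coboundary asboolF. Qed.

Lemma d1_linear : linear d1.
Proof.
move=> a f f'; apply/funext => s; rewrite !fctE.
have [os|os] := pselect (osimplex X s); last by rewrite !d1_out // scaler0 addr0.
rewrite !d1E // /boundary_value /= [in RHS]scalerDr [in RHS]scalerBr.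
by rewrite [RHS]addrACA opprD; congr (_ + _); exact: addrACA.
Qed.

Lemma edge_cochainP pi f : C1 pi f -> cochain X act pi (edge_cochain f).
Proof.
move=> [f0 fN fG]; split.
- move=> s os; apply: f0; apply/negP => /osimplex1P; exact: os.
- move=> t s os; rewrite /edge_cochain /osimplex_perm !ffunE.
  have [t0|t0] := ord2P (t ord0).
    have -> : t = 1%g.
      apply/permP => i; rewrite perm1; have [->//|->] := ord2P i.
      have [t1|//] := ord2P (t ord_max).
      by move: t0; rewrite -t1 => /perm_inj.
    by rewrite !perm1 odd_perm1 expr0 scale1r.
  have -> : t = tperm ord0 ord_max.
    apply/permP => i; have [->|->] := ord2P i; rewrite ?tpermL ?tpermR //.
    have [//|t1] := ord2P (t ord_max).
    by move: t0; rewrite -t1 => /perm_inj.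
  by rewrite tpermL tpermR odd_tperm /= expr1 scaleN1r fN.
- by move=> g s os; rewrite /edge_cochain /osimplex_act !ffunE fG.
Qed.

Lemma cochain_edge pi (c : {ffun 'I_2 -> V} -> E) : cochain X act pi c ->
  exists2 f, C1 pi f & edge_cochain f = c.
Proof.
pose pair v w : {ffun 'I_2 -> V} := [ffun i => if i == ord0 then v else w].
have pair0 v w : pair v w ord0 = v by rewrite ffunE eqxx.
have pair1 v w : pair v w ord_max = w by rewrite ffunE.
have pairK (s : {ffun 'I_2 -> V}) : pair (s ord0) (s ord_max) = s.
  by apply/ffunP => i; have [->|->] := ord2P i; rewrite ?pair0 ?pair1.
have opair v w : osimplex X (pair v w) <-> edge v w.
  by have := osimplex1P (pair v w); rewrite pair0 pair1.
move=> [c0 cN cG]; exists (fun q => c (pair q.1 q.2)); last first.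
  by apply/funext => s; rewrite /edge_cochain /= pairK.
have out v w : ~~ edge v w -> c (pair v w) = 0.
  by move=> /negP vw; apply: c0 => /opair.
split=> /=.
- exact: out.
- move=> v w; have [vw|vw] := boolP (edge v w); last first.
    by rewrite !out ?oppr0 // edge_sym.
  have := cN (tperm ord0 ord_max) _ ((opair v w).2 vw).
  rewrite odd_tperm /= expr1 scaleN1r => <-; congr c; apply/ffunP => i.
  rewrite [RHS]ffunE; have [->|->] := ord2P i.
    by rewrite tpermL pair0 pair1.
  by rewrite tpermR pair0 pair1.
- move=> g v w; have [vw|vw] := boolP (edge v w); last first.
    by rewrite !out ?linear0 // act_edge.
  rewrite -cG; last exact/opair; congr c; apply/ffunP => i.
  by rewrite [RHS]ffunE; have [->|->] := ord2P i; rewrite ?pair0 ?pair1.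
Qed.

Lemma d1_image pi :
  [set coboundary X c | c in @cochain R G E V X act pi 1] = [set d1 f | f in C1 pi].
Proof.
apply/seteqP; split=> _ [c Hc <-].
  by have [f Cf <-] := cochain_edge _ _ Hc; exists f.
by exists (edge_cochain c) => //; exact: edge_cochainP.
Qed.

(** The boundary value of an alternating [f] changes sign under the two adjacent transpositions,
    which generate all permutations of the triangle. *)
Lemma boundary_value_perm f u v w : (forall v w, f (w, v) = - f (v, w)) ->
  boundary_value f u v w = 0 ->
  [/\ boundary_value f v u w = 0, boundary_value f u w v = 0,
      boundary_value f w v u = 0, boundary_value f v w u = 0 &
      boundary_value f w u v = 0].
Proof.
move=> fN; have swap12 x y z : boundary_value f x y z = 0 -> boundary_value f y x z = 0.
  move=> H; rewrite -[RHS]oppr0 -H /boundary_value (fN x y) opprD opprB.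
  by [].
have swap23 x y z : boundary_value f x y z = 0 -> boundary_value f x z y = 0.
  move=> H; rewrite -[RHS]oppr0 -H /boundary_value (fN y z) !opprD opprK.
  by rewrite -!addrA; congr (_ + _); rewrite addrC.
by move=> H; split; auto.
Qed.

Lemma d1_Z1 pi n (r : 'I_n -> {ffun 'I_3 -> V}) f :
  orbit_representatives X act r -> C1 pi f -> (forall j, d1 f (r j) = 0) -> Z1 pi f.
Proof.
move=> [or_ orbits] Cf fr; have [f0 fN fG] := Cf; split=> // u v w Xuvw.
(* [Z1] also asks for the identity on degenerate triples, which are not ordered simplices and are
   settled separately. *)
have ff x : f (x, x) = 0 by apply: f0; rewrite edge_irrefl.
have [->|uv] := eqVneq u v; first by rewrite ff add0r.
have [->|vw] := eqVneq v w; first by rewrite ff addr0.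
have [->|uw] := eqVneq u w; first by rewrite ff fN addNr.
pose s : {ffun 'I_3 -> V} := [ffun i : 'I_3 => nth u [:: u; v; w] i].
have s0 : s ord0 = u by rewrite ffunE.
have s1 : s e1 = v by rewrite ffunE.
have s2 : s ord_max = w by rewrite ffunE.
have os : osimplex X s by apply/osimplex2P; rewrite s0 s1 s2.
suff : boundary_value f u v w = 0.
  rewrite /boundary_value => /eqP; rewrite addrAC subr_eq0 => /eqP <-.
  by rewrite addrC.
have [j [[g [t st]] _]] := orbits s os.
have : boundary_value f (r j ord0) (r j e1) (r j ord_max) = 0 by rewrite -d1E.
move=> /(boundary_value_perm _ _ _ _ fN) H.
have bG x y z : boundary_value f (act g x) (act g y) (act g z) =
    pi g (boundary_value f x y z).
  by rewrite /boundary_value !fG linearD linearB.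
have sE i : s i = act g (r j (t i)) by rewrite st !ffunE.
have tI := @perm_inj _ t.
rewrite -s0 -s1 -s2 !sE bG.
suff -> : boundary_value f (r j (t ord0)) (r j (t e1)) (r j (t ord_max)) = 0.
  by rewrite linear0.
have t01 : t ord0 != t e1 by apply/eqP => /tI.
have t12 : t e1 != t ord_max by apply/eqP => /tI.
have t02 : t ord0 != t ord_max by apply/eqP => /tI.
have b0 : boundary_value f (r j ord0) (r j e1) (r j ord_max) = 0 by rewrite -d1E.
have [? ? ? ? ?] := H.
case: (ord3P (t ord0)) (ord3P (t e1)) (ord3P (t ord_max)) t01 t12 t02.
all: move=> -> [] -> [] -> // _ _ _.
Qed.

Lemma Z1_d1 pi f s : Z1 pi f -> d1 f s = 0.
Proof.
move=> [_ Zf]; have [os|] := pselect (osimplex X s); last exact: d1_out.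
have [_ _ _ /Zf H] := (osimplex2P s).1 os.
by rewrite d1E // /boundary_value -H opprD addrA addrAC subrK subrr.
Qed.

Lemma d1_norm f (s : {ffun 'I_3 -> V}) m : (forall i j : 'I_3, `|f (s i, s j)| <= m) -> `|d1 f s| <= 3 * m.
Proof.
move=> fm; have [os|os] := pselect (osimplex X s); last first.
  by rewrite d1_out // normr0; have := fm ord0 ord0; have := normr_ge0 (f (s ord0, s ord0)); lra.
rewrite d1E // /boundary_value; apply: le_trans (ler_normD _ _) _.
have := ler_normB (f (s e1, s ord_max)) (f (s ord0, s ord_max)).
have := fm e1 ord_max; have := fm ord0 ord_max; have := fm ord0 e1; lra.
Qed.

(** * Bounded preimages under the coboundary when its image is closed *)

Section ReducedCohomology.
Variables (pi : representation G E) (n : nat) (r : 'I_n -> {ffun 'I_3 -> V}).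
Hypothesis r_reps : orbit_representatives X act r.
Hypothesis r_closed : closed
  [set ((fun j => h (r j)) : {ptws 'I_n -> E}) | h in [set d1 f | f in C1 pi]].

Definition triangle_reps : seq {ffun 'I_3 -> V} := [seq r j | j <- enum 'I_n].

Local Notation N2 := (maxnorm R E {ffun 'I_3 -> V} triangle_reps).

Lemma triangle_repsP j : r j \in triangle_reps.
Proof. by apply: map_f; rewrite mem_enum. Qed.

Lemma d1_image_seminormed :
  seminormed_subspace R ({ffun 'I_3 -> V} -> E) [set d1 f | f in C1 pi] N2.
Proof.
apply: maxnorm_seminormed.
  exists 0; first exact: C1_0.
  by have := d1_linear (-1) 0 0; rewrite !scaleN1r oppr0 addr0 addNr.
move=> a _ _ [f Cf <-] [f' Cf' <-]; exists (a *: f + f'); first exact: C1_lin.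
exact: d1_linear.
Qed.

(** Reducedness enters here. The limits of the values on representative triangles lie in the closed
    image, hence are the values of some coboundary [h]; as [N2] sees only these triangles, [h] is a
    limit for [N2]. *)
Lemma d1_image_complete :
  seminorm_complete R ({ffun 'I_3 -> V} -> E) [set d1 f | f in C1 pi] N2.
Proof.
move=> z rad Dz zr rS.
have /choice[l Hl] : forall j, exists l : E, (z m (r j) @[m --> \oo] --> l) /\
    forall m, `|l - z m (r j)| <= 2 * rad m.
  move=> j; have [|l zl Hl] := halving_cvg R E (fun m => z m (r j)) rad _ rS.
    move=> m; apply: le_trans (zr m).
    exact: (maxnorm_ge _ _ _ _ (z m.+1 - z m) _ (triangle_repsP j)).
  by exists l.
have : [set ((fun j => h (r j)) : {ptws 'I_n -> E}) | h in [set d1 f | f in C1 pi]] l.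
  have zl : {ptws, (fun m j => z m (r j)) @ \oo --> l}.
    apply: ptws_cvg => j; exact: (Hl j).1.
  apply: (closed_cvg _ r_closed _ _ zl); near=> m.
  by exists (z m).
move=> [h Dh hl]; exists h => // m.
apply: maxnorm_le => [|s /mapP[j _ ->]].
  by rewrite mulr_ge0 //; apply: le_trans (zr m); exact: maxnorm_ge0.
have -> : (h - z m) (r j) = l j - z m (r j) by rewrite -hl.
exact: (Hl j).2.
Unshelve. all: by end_near.
Qed.

Lemma d1_bound : exists2 B, 0 <= B & forall f, C1 pi f -> N2 (d1 f) <= B * N1 f.
Proof.
apply: maxnorm_bound; first exact: maxnorm_ge0.
move=> s; have /choice[C HC] : forall q : 'I_3 * 'I_3, exists C, forall f, C1 pi f ->
    `|f (s q.1, s q.2)| <= C * N1 f by move=> q; exact: C1_bound.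
exists (3 * \sum_q `|C q|) => f Cf; rewrite -mulrA; apply: d1_norm => i j.
apply: le_trans (HC (i, j) f Cf) _; rewrite ler_wpM2r ?maxnorm_ge0 //.
by rewrite (le_trans (ler_norm _)) // (bigD1 (i, j)) //= lerDl sumr_ge0.
Qed.

(** The open mapping theorem makes [d1 f] and [d1 h] agree only on representative triangles, and by
    [d1_Z1] this already makes [f - h] a cocycle. *)
Lemma d1_section : exists2 C, 0 <= C & forall f, C1 pi f ->
  exists h, [/\ C1 pi h, N1 h <= C * N2 (d1 f) & Z1 pi (f - h)].
Proof.
have [B _ HB] := d1_bound.
have [||C C0 HC] := open_mapping R _ _ _ _ _ _ d1 B (C1_seminormed pi)
    d1_image_seminormed (C1_complete pi) d1_linear HB d1_image_complete.
- by move=> f Cf; exists f.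
- by move=> _ [f Cf <-]; exists f.
exists C => // f Cf; have [|h [Ch Nh dfh]] := HC (d1 f); first by exists f.
exists h; split=> //; apply: (d1_Z1 _ _ r) => //.
  exact: (snsubB _ _ _ _ (C1_seminormed pi)).
move=> j; have -> : d1 (f - h) = d1 f - d1 h.
  by rewrite addrC -scaleN1r d1_linear scaleN1r addrC.
have := maxnorm_ge _ _ _ _ (d1 f - d1 h) _ (triangle_repsP j).
by rewrite dfh normr_le0 => /eqP.
Qed.

End ReducedCohomology.

(** * Fixed points, primitives of 1-cocycles, and stability *)

Lemma subr_swap (Z : zmodType) (a b c d : Z) : a - b = c - d -> a - c = b - d.
Proof.
move=> /eqP; rewrite subr_eq => /eqP->.
by rewrite -addrA -addrA addrC -addrA subrK addrC.
Qed.

Lemma C1_norm0 rho f : C1 rho f -> N1 f = 0 -> f = 0.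
Proof.
move=> Cf f0; apply/funext => q; have [C HC] := C1_bound rho q.
by have := HC f Cf; rewrite f0 mulr0 normr_le0 => /eqP.
Qed.

Hypothesis contrX : contractible R (realization R X).

(** A primitive [F] of [f] on the vertices need not be equivariant. Its defect [b g] is the same at
    every vertex because [X] is connected, so it is the translation part of an affine action;
    subtracting a fixed point makes [F] equivariant. *)
Lemma fixed_point_Z1 pi : affine_fixed_point_property pi ->
  forall f, Z1 pi f -> exists2 c, C0 pi c & d0 c = f.
Proof.
move=> hfix f [[f0 fN fG] Zf].
have [F FE] := contractible_primitive R V X contrX E (fun v w => f (v, w)) Zf.
have [y0 _] := contrX; have [v0 _] := open_star_cover R V X y0.
have edgeF v w : edge v w -> F w - F v = f (v, w).
  by move=> /edgeP[_ /FE].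
pose b g := F (act g v0) - pi g (F v0).
have bE g v : b g = F (act g v) - pi g (F v).
  apply: (contractible_connected R V X contrX E
    (fun v => F (act g v) - pi g (F v))) => {}v w Xvw.
  have [->//|vw] := eqVneq v w; have evw : edge v w by apply/edgeP.
  apply/esym/subr_swap; rewrite -linearB !edgeF ?act_edge // fG.
have [|x0 Hx0] := hfix (fun g x => pi g x + b g).
  split.
  - by move=> x; rewrite /b act1 !rep1 subrr addr0.
  - move=> g h x; rewrite (bE g (act h v0)) /b actM !repM linearD linearB.
    by rewrite -[RHS]addrA; congr (_ + _); rewrite [RHS]addrC addrA subrK.
  - by exists b.
exists (fun v => F v - x0).
  move=> g v; rewrite linearB; apply: subr_swap; rewrite -bE.
  by rewrite -{1}(Hx0 g) addrAC subrr add0r.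
apply/funext => -[v w]; rewrite /d0 /=; case: ifP => [vw|/negbT/f0->//].
by rewrite opprB addrA subrK edgeF.
Qed.

(** The map [F], with value 0 at the selected lifts, is equivariant for the affine action. If [c] is
    a [rho]-equivariant primitive of [d0 F], then [F - c] is constant, and equivariance makes its
    value a fixed point. *)
Lemma Z1_fixed_point rho : (forall f, Z1 rho f -> exists2 c, C0 rho c & d0 c = f) ->
  affine_fixed_point_property rho.
Proof.
move=> H1 a [a1 aM [b aE]].
have aB g x y : a g x - a g y = rho g (x - y).
  by rewrite !aE linearB opprD addrACA subrr addr0.
pose F v := a (tr v) 0.
have FG g v : F (act g v) = a g (F v) by rewrite /F tr_act aM.
have [|c Cc cF] := H1 (d0 F).
  by apply: d0_Z1 => g v w _; rewrite !FG aB.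
have [y0 _] := contrX; have [v0 _] := open_star_cover R V X y0.
exists (F v0 - c v0) => g.
have Fcv : F v0 - c v0 = F (act g v0) - c (act g v0).
  apply: (contractible_connected R V X contrX E (fun v => F v - c v)) => v w Xvw.
  have [->//|vw] := eqVneq v w; have evw : edge v w by apply/edgeP.
  apply/esym/subr_swap.
  by have := congr1 (fun f => f (v, w)) cF; rewrite /d0 /= evw.
rewrite {2}Fcv FG Cc -[LHS](subrK (a g (F v0))) aB addrAC subrr add0r.
by rewrite linearN addrC.
Qed.

Lemma d0_section pi : affine_fixed_point_property pi ->
  exists2 C, 0 <= C & forall f, Z1 pi f ->
    exists c, [/\ C0 pi c, N0 c <= C * N1 f & d0 c = f].
Proof.
move=> hfix; have [B _ HB] := d0_bound pi.
have [||C C0_ HC] := open_mapping R _ _ _ _ _ _ d0 B (C0_seminormed pi)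
    (Z1_seminormed pi) (C0_complete pi) d0_linear HB (Z1_complete pi).
- exact: d0_C0_Z1.
- exact: fixed_point_Z1.
exists C => // f Zf; have [c [Cc Nc Nfc]] := HC f Zf; exists c; split=> //.
apply/esym/eqP; rewrite -subr_eq0; apply/eqP; apply: (C1_norm0 pi) => //.
apply: (snsubB _ _ _ _ (C1_seminormed pi)); first by case: Zf.
by have [] := d0_C0_Z1 _ _ Cc.
Qed.

Lemma stability (S : {fset G}) pi : generates S -> H2_reduced X act pi ->
  affine_fixed_point_property pi ->
  exists2 eps : R, 0 < eps & forall rho : representation G E,
    eps_deformation S eps pi rho -> affine_fixed_point_property rho.
Proof.
move=> hS [n [r [r_reps]]]; rewrite d1_image => r_closed hfix.
have [A A0 HA] := d1_section pi n r r_reps r_closed.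
have [B B0 HB] := d0_section pi hfix.
(* The vertices of representative triangles enter the estimate of the coboundary of a transferred
   1-cochain, the ends of representative edges that of the transferred 0-cochain. *)
pose L := [seq tr (r q.1 q.2) | q <- [seq (j, i) | j <- enum 'I_n, i <- enum 'I_3]]
  ++ [seq tr q.1 | q <- edge_reps] ++ [seq tr q.2 | q <- edge_reps].
have LT j i : tr (r j i) \in L.
  rewrite mem_cat; apply/orP; left; apply/mapP; exists (j, i) => //.
  by apply/allpairsP; exists (j, i); rewrite !mem_enum.
have L1 q : q \in edge_reps -> tr q.1 \in L.
  by move=> qr; rewrite !mem_cat (map_f (fun q => tr q.1) qr) orbT.
have L2 q : q \in edge_reps -> tr q.2 \in L.
  by move=> qr; rewrite !mem_cat (map_f (fun q => tr q.2) qr) !orbT.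
(* [B] times the bound for [g' - h], where [g'] is the transfer of [g]: the norm of [g'] is at most
   [N1 g], and that of [h] at most [3 * A * N1 g], a triangle having three edges. *)
pose C := B * (1 + 3 * A).
have C0_ : 0 <= C by rewrite mulr_ge0 // addr_ge0 // mulr_ge0.
(* With [d = k^-1] the new residual is at most [(3 * A + 2 * C) * d * N1 g], where [2 * C] stands
   for the two ends of an edge. The summand 1 ensures [d <= 1], and the outer 2 the halving. *)
pose k := 2 * (1 + 3 * A + 2 * C).
have k2 : 2 <= k.
  by rewrite /k -[leLHS]mulr1 ler_pM2l // -addrA lerDl addr_ge0 // mulr_ge0.
have k0 : 0 < k by lra.
pose d := k^-1; have d0_ : 0 < d by rewrite invr_gt0.
have [eps eps0 Heps] := deformation_close_seq R G E S pi L d hS d0_.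
exists eps => // rho /Heps close; apply: Z1_fixed_point => f Zf.
have step g : Z1 rho g -> exists c, [/\ C0 rho c, N0 c <= C * N1 g &
    N1 (g - d0 c) <= N1 g / 2].
  move=> Zg; have [Cg _] := Zg.
  have [h [Ch Nh Zh]] := HA _ (transfer1_C1 pi g).
  have [c [Cc Nc dc]] := HB _ Zh.
  set N := N1 g in Nh *; have N_0 : 0 <= N by exact: maxnorm_ge0.
  have dN1 : d * N <= N by rewrite -[leRHS]mul1r ler_wpM2r // invf_le1 //; lra.
  have {}Nh : N1 h <= 3 * A * (d * N).
    apply: le_trans Nh _; rewrite [3 * A]mulrC -[leRHS]mulrA ler_wpM2l //.
    apply: maxnorm_le => [|_ /mapP[j _ ->]]; first by rewrite !mulr_ge0 // ltW.
    (* Since [g] is a cocycle, the coboundary of its transfer measures only the distance between the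
       two. *)
    have -> : d1 (transfer1 pi g) (r j) = d1 (transfer1 pi g - g) (r j).
      have -> : d1 (transfer1 pi g - g) = d1 (transfer1 pi g) - d1 g.
        by rewrite addrC -scaleN1r d1_linear scaleN1r addrC.
      by rewrite -[LHS]subr0 -(Z1_d1 rho g (r j) Zg).
    apply: d1_norm => i i'.
    by apply: (transfer1_close pi rho) => // [x|x|]; [exact: close|exact: close|exact: ltW].
  have {}Nc : N0 c <= C * N.
    apply: le_trans Nc _; rewrite /C -mulrA ler_wpM2l //.
    apply: le_trans (snormB _ _ _ _ (C1_seminormed pi) _ _) _.
    rewrite mulrDl mul1r; apply: lerD.
      apply: maxnorm_le => // q qr.
      by rewrite (transfer1_reps rho) //; exact: maxnorm_ge.
    by apply: le_trans Nh _; rewrite ler_wpM2l // mulr_ge0.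
  exists (transfer0 rho c); split; first exact: transfer0_C0.
    by rewrite transfer0_norm.
  apply: maxnorm_le => [|q qr]; first by rewrite divr_ge0.
  have gq : g q = h q + d0 c q.
    have -> : d0 c q = transfer1 pi g q - h q by rewrite dc.
    by rewrite addrC subrK (transfer1_reps rho).
  have hq : `|h q| <= 3 * A * (d * N) by apply: le_trans Nh; exact: maxnorm_ge.
  have cq v : tr v \in L -> `|c v - transfer0 rho c v| <= d * (C * N).
    move=> vL; apply: le_trans (_ : d * N0 c <= _); last by rewrite ler_pM2l.
    by apply: (transfer0_close pi) => // [x|]; [exact: close|exact: ltW].
  have dcq : `|d0 c q - d0 (transfer0 rho c) q| <= d * (C * N) + d * (C * N).
    have dCN : 0 <= d * (C * N) by rewrite mulr_ge0 ?(ltW d0_) // mulr_ge0.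
    rewrite /d0; case: ifP => _; last by rewrite subrr normr0 addr_ge0.
    rewrite opprD addrACA -opprD.
    apply: le_trans (ler_normB _ _) _.
    by apply: lerD; apply: cq; [exact: L2|exact: L1].
  have -> : (g - d0 (transfer0 rho c)) q = h q + (d0 c q - d0 (transfer0 rho c) q).
    by rewrite addrA -gq.
  apply: le_trans (ler_normD _ _) _; apply: le_trans (lerD hq dcq) _.
  have -> : N / 2 = k * (d * N) / 2 by rewrite mulrA divff ?mul1r // gt_eqF.
  have -> : d * (C * N) = C * (d * N) by ring.
  have : 0 <= d * N by rewrite mulr_ge0 // ltW.
  rewrite /k; move: (d * N) => x x0; rewrite -subr_ge0.
  by rewrite (_ : _ - _ = x) //; field.
(* [B'] depends on [rho], but it is used only for passing to the limit in the iteration and does not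
   affect [eps]. *)
have [B' _ HB'] := d0_bound rho.
have [|c [Cc _ Nfc]] := successive_approximation R _ _ _ _ _ _ d0 B'
    (C0_seminormed rho) (Z1_seminormed rho) (C0_complete rho) d0_linear HB'
    (Z1 rho) C _ step f Zf.
  move=> z c Zz Cc; apply: (snsubB _ _ _ _ (Z1_seminormed rho)) => //.
  exact: d0_C0_Z1.
exists c => //; apply/esym/eqP; rewrite -subr_eq0; apply/eqP.
apply: (C1_norm0 rho) => //; apply: (snsubB _ _ _ _ (C1_seminormed rho)).
  by case: Zf.
by have [] := d0_C0_Z1 _ _ Cc.
Qed.

End Cochains.
End Cover.

Local Close Scope classical_set_scope.

Theorem theorem3 (R : realType) (G : groupType) (S : {fset G})
    (E : completeNormedModType R) (pi : representation G E)
    (V W : choiceType) (X : simplicial_complex V) (K : simplicial_complex W)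
    (p : V -> W) (act : G -> V -> V)
    (hG : finitely_presented G) (hS : generates S)
    (hX : EilenbergMacLane_universal_cover X K R p act)
    (hred : H2_reduced X act pi)
    (hfix : affine_fixed_point_property pi) :
  exists2 eps : R, 0 < eps &
    forall rho : representation G E,
      eps_deformation S eps pi rho -> affine_fixed_point_property rho.
Proof.
have [ws [sel [tr [nb cd]]]] := cover_dataP R G V W X K p act hX.
have [_ contrX _ _ _] := hX.
exact: (stability R G V W X p act ws sel tr nb cd E contrX S pi hS hred hfix).
Qed.
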